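(* Assume (A1), (A2), (A4), (Ã3), (Ã5), and let $\phi$ be $\mu_\phi$-strongly convex and $\psi=f+\phi$ be $\mu$-strongly convex, with $\mu_\phi I-M_N\succeq\mu I$; let $x^\star$ be the unique minimizer of $\psi$. Consider Algorithm SNSPP with $S=\infty$, Option I, constant step sizes $\alpha_k^s=\alpha>0$ and constant batch sizes $b_k^s=b$, where $\alpha\le[L+\sqrt{2/b}\,m\bar L]^{-1}$. Suppose the tolerances satisfy $\epsilon_k^s\le\delta_s\|F_{\mathrm{nat}}(\tilde x^s)\|$ for all $0\le k<m$ and $s$, for a sequence $\delta_s>0$ with $\delta_s\to0$. Then there exist a constant $C>0$ independent of $s$ and an index $s_0$ such that for all $s\ge s_0$ $$\mathbb{E}\|\tilde x^{s+1}-x^\star\|^2\le\Big[1-\frac{2\alpha\mu}{1+\alpha(\mu_\phi+\mu)}+C\delta_s\Big]\mathbb{E}\|\tilde x^s-x^\star\|^2 .$$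
   Context: Problem: $\min_x\psi(x)=f(x)+\phi(x)$, $f(x)=\frac1N\sum_{i=1}^N f_i(A_ix)$, $A_i\in\mathbb{R}^{m_i\times n}$, $f_i:\mathbb{R}^{m_i}\to\mathbb{R}$ continuously differentiable, $\phi:\mathbb{R}^n\to(-\infty,\infty]$ proper closed convex. $\hat f_i(z)=f_i(z)+\frac{\gamma_i}{2}\|z\|^2$, $\hat f_i^\ast$ its conjugate, $\mathcal D_i=\operatorname{int}\operatorname{dom}\hat f_i^\ast$. Assumptions: (A1) each $f_i$ is $L_i$-smooth and $\gamma_i$-weakly convex; (A2) $\psi^\star:=\inf\psi>-\infty$; (A4) each $\hat f_i^\ast$ is essentially differentiable with locally Lipschitz gradient on $\mathcal D_i\ne\emptyset$; (Ã3) $\operatorname{prox}_{\alpha\phi}$ is $\nu$-order semismooth for all $\alpha>0$ ($0<\nu\le1$); (Ã5) each $\nabla\hat f_i^\ast$ is $\nu$-order semismooth on $\mathcal D_i$. Notation: for a $b$-tuple $\mathcal S=(\kappa(1),\dots,\kappa(b))$ of elements of $[N]$: $f_{\mathcal S}(x)=\frac1b\sum_j f_{\kappa(j)}(A_{\kappa(j)}x)$, $\nabla f_{\mathcal S}(x)=\frac1b\sum_jA_{\kappa(j)}^\top\nabla f_{\kappa(j)}(A_{\kappa(j)}x)$, $M_{\mathcal S}=\frac1b\sum_j\gamma_{\kappa(j)}A_{\kappa(j)}^\top A_{\kappa(j)}$, $M_N=\frac1N\sum_i\gamma_iA_i^\top A_i$, $\mathcal A_{\mathcal S}=\frac1b(A_{\kappa(1)}^\top,\dots,A_{\kappa(b)}^\top)^\top$,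 $\mathcal D=\prod_j\mathcal D_{\kappa(j)}$, and for $\alpha>0$, $x,v\in\mathbb{R}^n$ the map $\mathcal V=(\mathcal V_1,\dots,\mathcal V_b)$, $\mathcal V_j(\xi)=\nabla\hat f^\ast_{\kappa(j)}(\xi_j)-A_{\kappa(j)}\operatorname{prox}_{\alpha\phi}(x-\alpha\mathcal A_{\mathcal S}^\top\xi+v)$, where $\operatorname{prox}_g(y)=\operatorname{argmin}_wg(w)+\frac12\|y-w\|^2$. Constants: $L$ = Lipschitz constant of $\nabla f$; $\bar L=\max_iL_i\|A_i\|^2$; $\bar A=\max_i\|A_i\|^2$; $\bar M=\max_i\gamma_i\cdot\bar A$; $\mu_\ast=\min_i1/(L_i+\gamma_i)$. $F^\alpha_{\mathrm{nat}}(x)=x-\operatorname{prox}_{\alpha\phi}(x-\alpha\nabla f(x))$, $F_{\mathrm{nat}}=F^1_{\mathrm{nat}}$. Algorithm SNSPP: inputs $\tilde x^0\in\mathbb{R}^n$, $m\in\mathbb N$, $S\in\mathbb N\cup\{\infty\}$, step sizes $\alpha_k^s>0$, batch sizes $b_k^s$, tolerances $\epsilon_k^s\ge0$. For $s=0,1,\dots,S$: set $x^{s,0}=\tilde x^s$; for $k=0,\dots,m-1$: draw a $b_k^s$-tuple $\mathcal S_k^s$ with entries i.i.d. uniform on $[N]$ (with replacement), independent of the past; set $v^{s,k}=\nabla f(\tilde x^s)-\nabla f_{\mathcal S_k^s}(\tilde x^s)$ and $\hat v^{s,k}=\alpha_k^s(v^{s,k}-M_{\mathcal S_k^s}x^{s,k})$;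 compute any $\xi^{s,k+1}\in\mathcal D$ with $\|\mathcal V(\xi^{s,k+1})\|\le\epsilon_k^s$, where $\mathcal V$ uses data $(\mathcal S,\alpha,x,v)=(\mathcal S_k^s,\alpha_k^s,x^{s,k},-\hat v^{s,k})$; set $x^{s,k+1}=\operatorname{prox}_{\alpha_k^s\phi}(x^{s,k}-\alpha_k^s\mathcal A_{\mathcal S_k^s}^\top\xi^{s,k+1}-\hat v^{s,k})$. Then Option I: $\tilde x^{s+1}=x^{s,m}$; Option II: $\tilde x^{s+1}=\frac1m\sum_{k=1}^mx^{s,k}$. Output: $\tilde x^{S+1}$ and $x_\pi$ drawn uniformly from $\{x^{s,k}:0\le k<m,\ 0\le s\le S\}$. *)

(* Defs.v *)
From HB Require Import structures.
From mathcomp Require Import all_boot all_order all_algebra.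
From mathcomp Require Import all_classical all_reals all_analysis.
Set Implicit Arguments. Unset Strict Implicit. Unset Printing Implicit Defensive.
Import Order.TTheory GRing.Theory Num.Theory.
Import numFieldNormedType.Exports.
Local Open Scope classical_set_scope.
Local Open Scope ring_scope.

Section Euclid.
Variable R : realType.

Definition dotv p (u v : 'cV[R]_p) : R := \sum_(i < p) u i 0 * v i 0.
Definition nrm2 p (u : 'cV[R]_p) : R := Num.sqrt (dotv u u).

Definition opnorm q p (M : 'M[R]_(q, p)) : R :=
  sup [set nrm2 (M *m x) | x in [set x : 'cV[R]_p | nrm2 x <= 1]].

Definition grad p (g : 'cV[R]_p -> R) (z : 'cV[R]_p) : 'cV[R]_p :=
  \col_(k < p) ('d g z (delta_mx k 0 : 'cV[R]_p)).

Definition jac p q (G : 'cV[R]_p -> 'cV[R]_q) (z : 'cV[R]_p) : 'M[R]_(q, p) :=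
  \matrix_(i < q, j < p) ('d G z (delta_mx j 0 : 'cV[R]_p)) i 0.
End Euclid.

Section Convex.
Variable R : realType.
Local Open Scope ereal_scope.

Definition convex_fun p (g : 'cV[R]_p -> R) : Prop :=
  forall x y (t : R), (0 <= t <= 1)%R ->
    (g (t *: x + (1 - t) *: y) <= t * g x + (1 - t) * g y)%R.

Definition convex_efun p (g : 'cV[R]_p -> \bar R) : Prop :=
  forall x y (t : R), (0 < t < 1)%R ->
    g (t *: x + (1 - t) *: y)%R <= t%:E * g x + (1 - t)%:E * g y.

(** mu-strong convexity: g - (mu/2)||.||^2 is convex, i.e. *)
Definition strongly_convex_efun p (mu : R) (g : 'cV[R]_p -> \bar R) : Prop :=
  forall x y (t : R), (0 < t < 1)%R ->
    g (t *: x + (1 - t) *: y)%R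
      <= t%:E * g x + (1 - t)%:E * g y
         - (mu / 2 * t * (1 - t) * nrm2 (x - y) ^+ 2)%:E.

Definition proper_efun p (g : 'cV[R]_p -> \bar R) : Prop :=
  (forall x, g x != -oo) /\ (exists x, g x < +oo).

Definition lsc_efun p (g : 'cV[R]_p -> \bar R) : Prop :=
  forall x (a : \bar R), a < g x -> \forall y \near x, a < g y.

Definition conj_fun p (h : 'cV[R]_p -> R) (y : 'cV[R]_p) : \bar R :=
  ereal_sup (range (fun z => ((dotv y z) - h z)%:E)).

Definition edom p (g : 'cV[R]_p -> \bar R) : set 'cV[R]_p := [set y | g y < +oo].

(** prox_{a g}(y) = argmin_w a g(w) + 1/2 ||y - w||^2 (chosen via xget; it is
    unique for proper closed convex g and a > 0). *)
Definition is_prox p (a : R) (g : 'cV[R]_p -> \bar R) (y w : 'cV[R]_p) : Prop :=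
  forall u, a%:E * g w + (nrm2 (y - w)%R ^+ 2 / 2)%:E
            <= a%:E * g u + (nrm2 (y - u)%R ^+ 2 / 2)%:E.

Definition prox p (a : R) (g : 'cV[R]_p -> \bar R) (y : 'cV[R]_p) : 'cV[R]_p :=
  xget 0%R [set w | is_prox a g y w].
End Convex.

Section Smooth.
Variable R : realType.

Definition Lsmooth p (L : R) (g : 'cV[R]_p -> R) : Prop :=
  (forall z, differentiable g z) /\
  (forall z z', nrm2 (grad g z - grad g z') <= L * nrm2 (z - z')).

Definition weakly_convex p (gam : R) (g : 'cV[R]_p -> R) : Prop :=
  0 <= gam /\ convex_fun (fun z => g z + gam / 2 * nrm2 z ^+ 2).

Definition lipschitz_on p q (U : set 'cV[R]_p) (G : 'cV[R]_p -> 'cV[R]_q) (K : R) :=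
  forall y z, U y -> U z -> nrm2 (G y - G z) <= K * nrm2 (y - z).

Definition locally_lipschitz_on p q (U : set 'cV[R]_p) (G : 'cV[R]_p -> 'cV[R]_q) :=
  forall x, U x -> exists r K, 0 < r /\
    lipschitz_on [set y | U y /\ nrm2 (y - x) < r] G K.

(** Essential differentiability (Rockafellar's essential smoothness) of an
    extended-valued function h on R^p: int dom h nonempty, h differentiable on
    int dom h, and ||grad h(y_k)|| -> +oo whenever y_k in int dom h tends to a
    boundary point of int dom h. [fine \o h] is the real-valued version of h,
    which agrees with h near any point of int dom h. *)
Definition ess_differentiable p (h : 'cV[R]_p -> \bar R) : Prop :=
  let D := (edom h)° in
  D !=set0 /\
  (forall y, D y -> differentiable (fine \o h) y) /\
  (forall (u : nat -> 'cV[R]_p) (y : 'cV[R]_p),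
      (forall k, D (u k)) -> u @ \oo --> y -> ~ D y ->
      (fun k => nrm2 (grad (fine \o h) (u k))) @ \oo --> +oo).

Definition bjac p q (U : set 'cV[R]_p) (G : 'cV[R]_p -> 'cV[R]_q) (x : 'cV[R]_p)
    : set 'M[R]_(q, p) :=
  [set J | exists u : nat -> 'cV[R]_p,
     (forall k, U (u k) /\ differentiable G (u k)) /\
     u @ \oo --> x /\ (fun k => jac G (u k)) @ \oo --> J].

Definition mx_conv_hull q p (S : set 'M[R]_(q, p)) : set 'M[R]_(q, p) :=
  [set J | exists (k : nat) (w : 'I_k -> R) (Js : 'I_k -> 'M[R]_(q, p)),
     (forall i, 0 <= w i) /\ \sum_(i < k) w i = 1 /\ (forall i, S (Js i)) /\
     J = \sum_(i < k) w i *: Js i].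

Definition clarke_jac p q (U : set 'cV[R]_p) (G : 'cV[R]_p -> 'cV[R]_q) x :=
  mx_conv_hull (bjac U G x).

Definition semismooth_at (nu : R) p q (U : set 'cV[R]_p)
    (G : 'cV[R]_p -> 'cV[R]_q) (x : 'cV[R]_p) : Prop :=
  (exists r K, 0 < r /\ lipschitz_on [set y | nrm2 (y - x) < r] G K) /\
  (forall d : 'cV[R]_p,
      cvg ((fun t : R => t^-1 *: (G (x + t *: d) - G x)) @ 0^'+)) /\
  (exists C r, 0 < r /\ forall h : 'cV[R]_p, nrm2 h < r -> U (x + h) ->
     forall J, clarke_jac U G (x + h) J ->
       nrm2 (G (x + h) - G x - J *m h) <= C * (nrm2 h) `^ (1 + nu)).

Definition semismooth_on (nu : R) p q (U : set 'cV[R]_p) (G : 'cV[R]_p -> 'cV[R]_q) :=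
  forall x, U x -> semismooth_at nu U G x.
End Smooth.

Unset Implicit Arguments.

Section SNSPP.
Variables (R : realType) (N n : nat) (m : 'I_N -> nat).
Variable A : forall i : 'I_N, 'M[R]_(m i, n).
Variable f : forall i : 'I_N, 'cV[R]_(m i) -> R.
Variable gam : 'I_N -> R.
Variable phi : 'cV[R]_n -> \bar R.

Definition fsum (x : 'cV[R]_n) : R := N%:R^-1 * \sum_(i < N) f i (A i *m x).
Definition psi (x : 'cV[R]_n) : \bar R := ((fsum x)%:E + phi x)%E.

Definition fhat (i : 'I_N) (z : 'cV[R]_(m i)) : R := f i z + gam i / 2 * nrm2 z ^+ 2.
Definition fhat_conj (i : 'I_N) : 'cV[R]_(m i) -> \bar R := conj_fun (fhat i).
Definition Dom (i : 'I_N) : set 'cV[R]_(m i) := (edom (fhat_conj i))°.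
Definition grad_fhat_conj (i : 'I_N) (y : 'cV[R]_(m i)) : 'cV[R]_(m i) :=
  grad (fine \o fhat_conj i) y.

Definition gradf (x : 'cV[R]_n) : 'cV[R]_n :=
  N%:R^-1 *: \sum_(i < N) ((A i)^T *m grad (f i) (A i *m x)).
Definition MN : 'M[R]_n := N%:R^-1 *: \sum_(i < N) (gam i *: ((A i)^T *m A i)).

Definition Fnat (x : 'cV[R]_n) : 'cV[R]_n := x - prox 1 phi (x - gradf x).

Variable b : nat.
Definition batch := {ffun 'I_b -> 'I_N}.
(** A dual variable xi = (xi_1,...,xi_b) with xi_j in R^{m_kappa(j)}; for typing
    reasons it is given as a family xi j i in R^{m_i} of which only the
    component i = kappa(j) is used. *)
Definition dualv := 'I_b -> forall i : 'I_N, 'cV[R]_(m i).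

Definition gradfS (K : batch) (x : 'cV[R]_n) : 'cV[R]_n :=
  b%:R^-1 *: \sum_(j < b) ((A (K j))^T *m grad (f (K j)) (A (K j) *m x)).
Definition MS (K : batch) : 'M[R]_n :=
  b%:R^-1 *: \sum_(j < b) (gam (K j) *: ((A (K j))^T *m A (K j))).
Definition ASt (K : batch) (xi : dualv) : 'cV[R]_n :=
  b%:R^-1 *: \sum_(j < b) ((A (K j))^T *m xi j (K j)).

Definition Vnorm (K : batch) (alpha : R) (x v : 'cV[R]_n) (xi : dualv) : R :=
  let p := prox alpha phi (x - alpha *: ASt K xi + v) in
  Num.sqrt (\sum_(j < b)
     nrm2 (grad_fhat_conj (K j) (xi j (K j)) - A (K j) *m p) ^+ 2).

Variables (alpha : R) (mm : nat) (x0 : 'cV[R]_n).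

Definition vhat (K : batch) (xt x : 'cV[R]_n) : 'cV[R]_n :=
  alpha *: ((gradf xt - gradfS K xt) - MS K *m x).

(** The subproblem solver: given the history of drawn batches (most recent
    first; the head is the current batch S_k^s) it returns xi^{s,k+1}. *)
Variable sel : seq batch -> dualv.

(** [run hr] = (tilde x^s, x^{s,k}) after the draws in [hr] (most recent
    first), where size hr = s * mm + k, 0 <= k < mm.  Option I. *)
Fixpoint run (hr : seq batch) : 'cV[R]_n * 'cV[R]_n :=
  match hr with
  | [::] => (x0, x0)
  | K :: hr' =>
      let st := run hr' in
      let xt := st.1 in let x := st.2 in
      let x' := prox alpha phi (x - alpha *: ASt K (sel hr) - vhat K xt x) in
      if ((size hr').+1 %% mm == 0)%N then (x', x') else (xt, x')
  end.

(** Expectation over T i.i.d. uniform draws of batches (each batch itself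
    consisting of b i.i.d. uniform indices in [N]): the uniform average over
    all histories of length T. *)
Definition Exp (T : nat) (X : seq batch -> R) : R :=
  (#|{ffun 'I_T -> batch}|%:R)^-1 *
  \sum_(w : {ffun 'I_T -> batch}) X (rev (fgraph w)).
End SNSPP.

Definition Lbar (R : realType) (N n : nat) (m : 'I_N -> nat)
    (A : forall i : 'I_N, 'M[R]_(m i, n)) (Li : 'I_N -> R) : R :=
  \big[Num.max/0]_(i < N) (Li i * opnorm (A i) ^+ 2).

(* Main.v *)
Require Import Defs.
From HB Require Import structures.
From mathcomp Require Import all_boot all_order all_algebra.
From mathcomp Require Import all_classical all_reals all_analysis.
From mathcomp Require Import ring lra.
Import Order.TTheory GRing.Theory Num.Theory.
Import numFieldNormedType.Exports.
Local Open Scope classical_set_scope.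
Local Open Scope ring_scope.
(** With v the variance-reduction correction and M_S the batch regulariser, the
    iterate u = x^{s,k+1} solves, up to the dual residual r, the implicit equation
      u = prox_{alpha phi}(x - alpha (grad f_S(u) + M_S (u - x) + v + r)),
    because xi_j = grad fhat_j(z_j) whenever z_j = grad fhat_j^*(xi_j). Adding the
    strong-convexity inequality of the prox, the weak-convexity inequalities of
    f_S at u and at x, the descent lemma for f and the quadratic growth of psi
    at x* bounds (1 + alpha (mu_phi + mu)) |u - x*|^2 for every batch. In the
    mean over the batch the terms linear in f_S cancel, M_S becomes
    M_N <= (mu_phi - mu) I, and the gradient noise costs a multiple of
    |x - xt|^2, where xt is the epoch start. The squared step length |u - x|^2
    absorbs that cost along an epoch through a weighted potential
    |x - x*|^2 + P_k |x - xt|^2; the bound on alpha is exactly what makes the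
    weights admissible. The dual residual is O(delta_s) |xt - x*|, since F_nat
    is bounded by a multiple of the distance to x*, and perturbs the
    contraction factor by O(delta_s). *)

Set Implicit Arguments. Unset Strict Implicit. Unset Printing Implicit Defensive.

(** * Euclidean inner product, operator norm and compact balls *)

Section Euclidean.
Context {R : realType}.
Implicit Types (p q : nat).

Lemma dotvC p (u v : 'cV[R]_p) : dotv u v = dotv v u.
Proof. by apply: eq_bigr => i _; rewrite mulrC. Qed.

Lemma dotvDl p (u v w : 'cV[R]_p) : dotv (u + v) w = dotv u w + dotv v w.
Proof. by rewrite -big_split; apply: eq_bigr => i _; rewrite mxE mulrDl. Qed.

Lemma dotvZl p (a : R) (u v : 'cV[R]_p) : dotv (a *: u) v = a * dotv u v.
Proof. by rewrite mulr_sumr; apply: eq_bigr => i _; rewrite mxE mulrA. Qed.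

Lemma dotvNl p (u v : 'cV[R]_p) : dotv (- u) v = - dotv u v.
Proof. by rewrite -scaleN1r dotvZl mulN1r. Qed.

Lemma dotvDr p (u v w : 'cV[R]_p) : dotv u (v + w) = dotv u v + dotv u w.
Proof. by rewrite ![dotv u _]dotvC dotvDl. Qed.

Lemma dotvZr p (a : R) (u v : 'cV[R]_p) : dotv u (a *: v) = a * dotv u v.
Proof. by rewrite ![dotv u _]dotvC dotvZl. Qed.

Lemma dotvNr p (u v : 'cV[R]_p) : dotv u (- v) = - dotv u v.
Proof. by rewrite ![dotv u _]dotvC dotvNl. Qed.

Definition dotvE := (dotvDl, dotvDr, dotvNl, dotvNr, dotvZl, dotvZr).

Lemma dotv0l p (u : 'cV[R]_p) : dotv 0 u = 0.
Proof. by rewrite -(scale0r 0) dotvZl mul0r. Qed.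

Lemma dotv0r p (u : 'cV[R]_p) : dotv u 0 = 0.
Proof. by rewrite dotvC dotv0l. Qed.

Lemma dotv_suml p (I : finType) (F : I -> 'cV[R]_p) v :
  dotv (\sum_i F i) v = \sum_i dotv (F i) v.
Proof. by elim/big_ind2 : _ => [|? ? ? ? <- <-|]; rewrite ?dotv0l ?dotvDl. Qed.

Lemma dotv_sumr p (I : finType) (F : I -> 'cV[R]_p) v :
  dotv v (\sum_i F i) = \sum_i dotv v (F i).
Proof. by rewrite dotvC dotv_suml; apply: eq_bigr => i _; rewrite dotvC. Qed.

Lemma dotv_ge0 p (u : 'cV[R]_p) : 0 <= dotv u u.
Proof. by apply: sumr_ge0 => i _; rewrite -expr2 sqr_ge0. Qed.

Lemma nrm2_ge0 p (u : 'cV[R]_p) : 0 <= nrm2 u.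
Proof. exact: sqrtr_ge0. Qed.

Lemma sqr_nrm2 p (u : 'cV[R]_p) : nrm2 u ^+ 2 = dotv u u.
Proof. by rewrite sqr_sqrtr ?dotv_ge0. Qed.

Lemma nrm20 p : nrm2 (0 : 'cV[R]_p) = 0.
Proof. by rewrite /nrm2 dotv0l sqrtr0. Qed.

Lemma nrm2N p (u : 'cV[R]_p) : nrm2 (- u) = nrm2 u.
Proof. by rewrite /nrm2 !dotvE opprK. Qed.

Lemma nrm2Z p (a : R) (u : 'cV[R]_p) : nrm2 (a *: u) = `|a| * nrm2 u.
Proof.
by rewrite /nrm2 !dotvE mulrA -expr2 sqrtrM ?sqr_ge0 ?sqrtr_sqr.
Qed.

Lemma mulr_dotv_le p (a b : R) (u v : 'cV[R]_p) :
  2 * (a * b) * dotv u v <= a ^+ 2 * dotv u u + b ^+ 2 * dotv v v.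
Proof.
have := dotv_ge0 (a *: u - b *: v); rewrite !dotvE (dotvC v u); lra.
Qed.

Lemma nrm2_eq0 p (u : 'cV[R]_p) : nrm2 u = 0 -> u = 0.
Proof.
move=> w0; have : dotv u u == 0 by rewrite -sqr_nrm2 w0 expr0n.
rewrite psumr_eq0 => [/allP w0'|i _]; last by rewrite -expr2 sqr_ge0.
apply/colP => i; have := w0' i (mem_index_enum i).
by rewrite -expr2 sqrf_eq0 mxE => /eqP.
Qed.

(** Expanding the square of [nrm2 v *: u - nrm2 u *: v] gives the bound multiplied by
    [2 * nrm2 u * nrm2 v], which cancels once both norms are nonzero. *)
Lemma CauchySchwarz_dotv p (u v : 'cV[R]_p) : dotv u v <= nrm2 u * nrm2 v.
Proof.
have [/nrm2_eq0 ->|u0] := eqVneq (nrm2 u) 0.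
  by rewrite dotv0l mulr_ge0 ?nrm2_ge0.
have [/nrm2_eq0 ->|v0] := eqVneq (nrm2 v) 0.
  by rewrite dotv0r mulr_ge0 ?nrm2_ge0.
have {}u0 : 0 < nrm2 u by rewrite lt_neqAle eq_sym u0 nrm2_ge0.
have {}v0 : 0 < nrm2 v by rewrite lt_neqAle eq_sym v0 nrm2_ge0.
have := mulr_dotv_le (nrm2 v) (nrm2 u) u v; rewrite -!sqr_nrm2.
rewrite [X in _ <= X](_ : _ =
  2 * (nrm2 v * nrm2 u) * (nrm2 u * nrm2 v)); last by ring.
by rewrite ler_pM2l// !mulr_gt0.
Qed.

Lemma nrm2D p (u v : 'cV[R]_p) : nrm2 (u + v) <= nrm2 u + nrm2 v.
Proof.
rewrite -ler_sqr ?nnegrE ?addr_ge0 ?nrm2_ge0// sqrrD !sqr_nrm2 !dotvE (dotvC v u).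
have := CauchySchwarz_dotv u v; lra.
Qed.

Lemma nrm2_sum p (I : finType) (F : I -> 'cV[R]_p) :
  nrm2 (\sum_i F i) <= \sum_i nrm2 (F i).
Proof.
elim/big_ind2 : _ => [|u a v b ua vb|//]; first by rewrite nrm20.
exact: le_trans (nrm2D _ _) (lerD ua vb).
Qed.

Lemma coord_le_nrm2 p (u : 'cV[R]_p) i : `|u i 0| <= nrm2 u.
Proof.
rewrite -sqrtr_sqr ler_sqrt ?dotv_ge0// /dotv (bigD1 i)//= -expr2 lerDl.
by apply: sumr_ge0 => j _; rewrite -expr2 sqr_ge0.
Qed.

Lemma normr_le_nrm2 p (u : 'cV[R]_p) : `|u| <= nrm2 u.
Proof.
rewrite [leLHS]/Num.norm/= mx_normrE; apply/bigmax_leP.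
by split=> [|[i j] _]; rewrite ?nrm2_ge0// (ord1 j) coord_le_nrm2.
Qed.

Lemma dotv_delta p (u : 'cV[R]_p) i : dotv u (delta_mx i 0) = u i 0.
Proof.
rewrite /dotv (bigD1 i)//= mxE !eqxx mulr1 big1 ?addr0// => j /negPf ji.
by rewrite mxE ji mulr0.
Qed.

Lemma dotv_inj p (u v : 'cV[R]_p) : (forall w, dotv u w = dotv v w) -> u = v.
Proof. by move=> uv; apply/colP => i; rewrite -!dotv_delta. Qed.

Lemma dotv_mulmx p q (M : 'M[R]_(q, p)) (u : 'cV[R]_p) (v : 'cV[R]_q) :
  dotv (M *m u) v = dotv u (M^T *m v).
Proof.
rewrite /dotv (eq_bigr (fun i => \sum_j M i j * u j 0 * v i 0)); last first.
  by move=> i _; rewrite mxE mulr_suml.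
rewrite exchange_big; apply: eq_bigr => j _; rewrite mxE mulr_sumr.
by apply: eq_bigr => i _; rewrite mxE; ring.
Qed.

(** A crude row-wise bound, whose purpose is to show that the set under the [sup] in [opnorm] is
    bounded above. *)
Lemma nrm2_mulmx_bounded p q (M : 'M[R]_(q, p)) :
  exists2 B, 0 <= B & forall u : 'cV[R]_p, nrm2 (M *m u) <= B * nrm2 u.
Proof.
exists (\sum_i nrm2 (row i M)^T); first by apply: sumr_ge0 => i _; exact: nrm2_ge0.
move=> u; rewrite [M *m u](_ : _ = \sum_i (dotv (row i M)^T u *: delta_mx i 0)).
  apply: (le_trans (nrm2_sum _)); rewrite mulr_suml; apply: ler_sum => i _.
  rewrite nrm2Z [nrm2 (delta_mx _ _)](_ : _ = 1); last first.
    by rewrite /nrm2 dotv_delta mxE !eqxx sqrtr1.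
  rewrite mulr1 ler_norml CauchySchwarz_dotv andbT lerNl -dotvNl.
  by rewrite -(nrm2N (row i M)^T) CauchySchwarz_dotv.
apply/colP => i; rewrite summxE (bigD1 i)//= big1 => [|j /negPf ji].
  rewrite !mxE !eqxx mulr1 addr0; apply: eq_bigr => j _.
  by rewrite !mxE.
by rewrite !mxE eq_sym ji mulr0.
Qed.

Lemma nrm2_mulmx p q (M : 'M[R]_(q, p)) (u : 'cV[R]_p) :
  nrm2 (M *m u) <= opnorm M * nrm2 u.
Proof.
have [B B0 MB] := nrm2_mulmx_bounded M.
have [/nrm2_eq0 ->|u0] := eqVneq (nrm2 u) 0.
  by rewrite mulmx0 !nrm20 mulr0.
have {}u0 : 0 < nrm2 u by rewrite lt_neqAle eq_sym u0 nrm2_ge0.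
rewrite -ler_pdivrMr// mulrC.
have -> : (nrm2 u)^-1 * nrm2 (M *m u) = nrm2 (M *m ((nrm2 u)^-1 *: u)).
  by rewrite -scalemxAr nrm2Z ger0_norm// invr_ge0 ltW.
apply: ub_le_sup.
  exists B => _ [x /= x1 <-]; apply: (le_trans (MB _)).
  by rewrite -[leRHS]mulr1 ler_wpM2l.
exists ((nrm2 u)^-1 *: u) => //=.
by rewrite nrm2Z ger0_norm ?invr_ge0 ?(ltW u0)// mulVf ?lexx// (gt_eqF u0).
Qed.

Lemma opnorm_ge0 p q (M : 'M[R]_(q, p)) : 0 <= opnorm M.
Proof.
have [B B0 MB] := nrm2_mulmx_bounded M.
apply: ub_le_sup; last by exists 0; rewrite /= ?mulmx0 nrm20 ?ler01.
exists B => _ [x /= x1 <-]; apply: (le_trans (MB _)).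
by rewrite -[leRHS]mulr1 ler_wpM2l.
Qed.

(** The square of [nrm2 (M^T *m u)] is the inner product of [M *m (M^T *m u)] with [u];
    Cauchy-Schwarz and division by [nrm2 (M^T *m u)] conclude. *)
Lemma nrm2_mulmxT p q (M : 'M[R]_(q, p)) (u : 'cV[R]_q) :
  nrm2 (M^T *m u) <= opnorm M * nrm2 u.
Proof.
have [->|u0] := eqVneq (nrm2 (M^T *m u)) 0.
  by rewrite mulr_ge0 ?opnorm_ge0 ?nrm2_ge0.
have {}u0 : 0 < nrm2 (M^T *m u) by rewrite lt_neqAle eq_sym u0 nrm2_ge0.
rewrite -(ler_pM2r u0) -expr2 sqr_nrm2 -dotv_mulmx.
apply: (le_trans (CauchySchwarz_dotv _ _)).
rewrite [leRHS]mulrAC ler_wpM2r ?nrm2_ge0//; exact: nrm2_mulmx.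
Qed.

Lemma normr_trmx p q (M : 'M[R]_(p, q)) : `|M^T| = `|M|.
Proof.
rewrite /Num.norm/= !mx_normrE (reindex (fun ij => (ij.2, ij.1)))/=.
  by apply: eq_bigr => -[i j] _/=; rewrite !mxE.
by exists (fun ij => (ij.2, ij.1)) => -[].
Qed.

Lemma trmx_continuous p q : continuous (@trmx R p q).
Proof.
move=> M B /nbhs_ballP[e e0 eB]; apply/nbhs_ballP; exists e => // N MN.
by apply: eB; split=> // i j; rewrite !mxE; exact: MN.2.
Qed.

(** Heine-Borel is applied to row vectors and carried over to columns by transposition, an isometry
    for the entrywise maximum norm. *)
Lemma cball_compact p (x : 'cV[R]_p) (r : R) : compact [set y | `|y - x| <= r].
Proof.
have -> : [set y | `|y - x| <= r] = (@trmx R 1 p) @` [set y | `|y - x^T| <= r].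
  apply/seteqP; split => [y /= yx|_ [y /= yx <-]].
    by exists y^T; rewrite ?trmxK//= -linearB/= normr_trmx.
  by rewrite -normr_trmx linearB/= trmxK.
apply: continuous_compact; first exact/continuous_subspaceT/trmx_continuous.
apply: bounded_closed_compact.
  exists (r + `|x^T|); split=> [|M rM y /= yx]; first exact: num_real.
  rewrite (le_trans _ (ltW rM))// -[y](subrK x^T).
  by rewrite (le_trans (ler_normD _ _))// lerD2r.
rewrite (_ : mkset _ = closed_ball_ Num.norm x^T r); last first.
  by apply/seteqP; split => y /=; rewrite distrC.
exact: closed_closed_ball_.
Qed.

End Euclidean.

(** * First-order expansions and the descent inequality on a line *)

Section Gradient.
Context {R : realType}.
Implicit Types (p q : nat).

Lemma diff_dotv_grad p (f : 'cV[R]_p -> R) (z w : 'cV[R]_p) :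
  'd f z w = dotv (grad f z) w.
Proof.
have {1}-> : w = \sum_i w i 0 *: delta_mx i 0.
  by rewrite [LHS]matrix_sum_delta; apply: eq_bigr => i _; rewrite big_ord1.
rewrite linear_sum; apply: eq_bigr => i _.
by rewrite linearZ mxE/= mulrC.
Qed.

Lemma differentiable_grad p (f : 'cV[R]_p -> R) (z : 'cV[R]_p) (e : R) :
  differentiable f z -> 0 < e ->
  exists2 r, 0 < r & forall h, nrm2 h < r ->
    `|f (z + h) - f z - dotv (grad f z) h| <= e * nrm2 h.
Proof.
move=> df e0; have := diff_locallyxC df.
set k := 'o _ => fE.
have /eqoP/(_ e e0)/nbhs_ballP[r /= r0 rk] : k =o_ (0 : 'cV[R]_p) id by [].
exists r => // h hr.
have -> : f (z + h) - f z - dotv (grad f z) h = k h.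
  rewrite fE -diff_dotv_grad; set a := f z; set b := 'd f z h; set c := k h.
  by change (a + b + c - a - b = c); ring.
have /rk/= : ball (0 : 'cV[R]_p) r h.
  by rewrite -ball_normE/= sub0r normrN (le_lt_trans (normr_le_nrm2 h)).
by move/le_trans; apply; rewrite ler_pM2l// normr_le_nrm2.
Qed.

(** Divide by [t] and let [t] tend to 0. This is the common source of the first-order conditions
    below: any error of order [t ^+ 2] is harmless. *)
Lemma dotv_grad_ge p (f : 'cV[R]_p -> R) (z w : 'cV[R]_p) (a B : R) :
  differentiable f z ->
  (forall t, 0 < t < 1 -> t * a - t ^+ 2 * B <= f (z + t *: w) - f z) ->
  a <= dotv (grad f z) w.
Proof.
move=> df fB; apply/ler_addgt0Pr => e e0.
have W0 : 0 < nrm2 w + 1 by rewrite ltr_pwDr ?nrm2_ge0.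
have B0 : 0 < `|B| + 1 by rewrite ltr_pwDr.
have e'0 : 0 < e / 2 / (nrm2 w + 1) by rewrite !divr_gt0.
have [r r0 rf] := differentiable_grad df e'0.
(* The three caps keep [t] below 1, keep [t *: w] inside the radius of the expansion, and make
   [t * B] at most [e / 2]; the expansion error takes the other half of [e]. *)
pose t := Num.min (1 / 2) (Num.min (r / (nrm2 w + 1) / 2) (e / 2 / (`|B| + 1))).
have t0 : 0 < t by rewrite !lt_min !divr_gt0//.
have t1 : t < 1 by rewrite gt_min; apply/orP; left; lra.
have tr : nrm2 (t *: w) < r.
  rewrite nrm2Z gtr0_norm//.
  apply: (@le_lt_trans _ _ (t * (nrm2 w + 1))); first by rewrite ler_pM2l// lerDl.
  rewrite -ltr_pdivlMr// !gt_min; apply/orP; right; apply/orP; left.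
  by rewrite ltr_pdivrMr// ltr_pMr ?divr_gt0// ltr1n.
have tB : t * B <= e / 2.
  apply: (@le_trans _ _ (t * (`|B| + 1))).
    by rewrite ler_pM2l// (le_trans (ler_norm B))// lerDl.
  by rewrite -ler_pdivlMr// !ge_min lexx !orbT.
have := le_trans (ler_norm _) (rf _ tr); rewrite dotvZr nrm2Z gtr0_norm//.
have := fB t; rewrite t0 t1 => /(_ isT) h1 h2.
have eW : e / 2 / (nrm2 w + 1) * nrm2 w <= e / 2.
  rewrite mulrAC ler_pdivrMr// ler_pM2l ?divr_gt0//.
  by rewrite lerDl.
have : t * a <= t * (dotv (grad f z) w + t * B + e / 2 / (nrm2 w + 1) * nrm2 w).
  by move: h1 h2; lra.
by rewrite ler_pM2l//; lra.
Qed.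

Lemma is_derive_line p (f : 'cV[R]_p -> R) (z w : 'cV[R]_p) (t : R) :
  differentiable f (z + t *: w) ->
  is_derive t (1 : R) (fun s : R => f (z + s *: w)) (dotv (grad f (z + t *: w)) w).
Proof.
move=> df.
have dl : is_diff t (cst z + ( *:%R ^~ w) : R -> 'cV[R]_p) (0 + ( *:%R ^~ w)).
  exact: is_diffD.
have dfl : differentiable (f \o (cst z + ( *:%R ^~ w) : R -> 'cV[R]_p)) t.
  by apply: differentiable_comp => //; exact: ex_diff.
split; first exact: (@diff_derivable _ _ _ _ t 1 dfl).
rewrite (@deriveE _ _ _ _ t 1 dfl) diff_comp//=.
  rewrite diff_val/= -diff_dotv_grad; congr ('d f _ _).
  by rewrite -[LHS]/(0 + 1 *: w) scale1r add0r.
Qed.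

(** The mean value theorem for [h t - K / 2 * t ^+ 2] takes the place of integrating [dh]. *)
Lemma descent_line (h dh : R -> R) (K : R) :
  (forall t : R, is_derive t (1 : R) h (dh t)) ->
  (forall t : R, 0 < t < 1 -> dh t - dh 0 <= K * t) ->
  h 1 - h 0 <= dh 0 + K / 2.
Proof.
move=> hd hK.
pose g t := h t - K / 2 * t ^+ 2.
have gd (t : R) : is_derive t (1 : R) g (dh t - K * t).
  rewrite /g; apply: is_derive_eq.
  rewrite -[t%:A]/(t * 1) -[_ *: _]/(_ * _); lra.
have gc : {within `[0 : R, 1], continuous g}.
  apply/continuous_subspaceT => t.
  exact/differentiable_continuous/derivable1_diffP.
have [c /[!in_itv]/= c01 gE] := MVT (@ltr01 R) (fun t _ => gd t) gc.
have := hK c c01; move: gE; rewrite /g; lra.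
Qed.

End Gradient.

(** * The gradient of a conjugate attains its supremum *)

Section Conjugate.
Context {R : realType}.
Implicit Types (p q : nat).

Lemma dotv_continuous p (T : topologicalType) (u v : T -> 'cV[R]_p) (x : T) :
  {for x, continuous u} -> {for x, continuous v} ->
  {for x, continuous (fun t => dotv (u t) (v t))}.
Proof.
move=> cu cv; have cd i : {for x, continuous (fun t => u t i 0 * v t i 0)}.
  apply: (@continuousM _ _ (fun t => u t i 0) (fun t => v t i 0)).
    exact: continuous_comp cu (@coord_continuous _ _ _ _ _ _).
  exact: continuous_comp cv (@coord_continuous _ _ _ _ _ _).
by apply: cvg_big => [|i _]; [exact: add_continuous|exact: cd].
Qed.

Section attained.
Variables (p : nat) (h : 'cV[R]_p -> R) (y : 'cV[R]_p).
Let g := fine \o conj_fun h.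
Let z := grad g y.
Hypothesis yD : (edom (conj_fun h))° y.
Hypothesis dg : differentiable g y.

Let conj_ge w v : (((dotv w v) - h v)%:E <= conj_fun h w)%E.
Proof. by apply: ereal_sup_ubound; exists v. Qed.

Let conj_fin w : edom (conj_fun h) w -> conj_fun h w = (g w)%:E.
Proof.
move=> wD; rewrite /g/= fineK// fin_numE; apply/andP; split; last first.
  by rewrite lt_eqF.
by rewrite gt_eqF// (lt_le_trans _ (conj_ge w 0))// ltNyr.
Qed.

(* Testing a near-maximiser [w] at [y + t (w - z)] forces [w] close to [z]. *)
Let near_maximizer (e : R) : 0 < e ->
  exists w, nrm2 (w - z) <= e /\ g y - e <= dotv y w - h w.
Proof.
move=> e0; have e20 : 0 < e / 2 by rewrite divr_gt0.
have [r1 r10 gr] := differentiable_grad dg e20.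
have [r2 /= r20 Dr] := (nbhs_ballP _ _).1 yD.
pose r := Num.min r1 r2 / 2.
have m0 : 0 < Num.min r1 r2 by rewrite lt_min r10.
have r0 : 0 < r by rewrite divr_gt0.
have rm : r < Num.min r1 r2 by rewrite /r; lra.
have yDy : edom (conj_fun h) y by exact: interior_subset yD.
(* The slack [d] in the supremum and the expansion error are each at most [e / 2 * r], so together
   they bound [r * nrm2 (w - z)] by [r * e]. *)
pose d := Num.min e (e / 2 * r).
have d0 : 0 < d by rewrite lt_min e0 mulr_gt0.
have [_ [w _ <-]] : exists2 a, range (fun v => ((dotv y v) - h v)%:E) a &
    ((g y - d)%:E < a)%E.
  by apply: ereal_sup_gt; rewrite -/(conj_fun h y) conj_fin// lte_fin; lra.
rewrite lte_fin => wd; exists w; split; last first.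
  by have : d <= e by [rewrite ge_min lexx]; move: wd; lra.
have [->|wz] := eqVneq (nrm2 (w - z)) 0; first exact: ltW.
have {}wz : 0 < nrm2 (w - z) by rewrite lt_neqAle eq_sym wz nrm2_ge0.
pose v := (r / nrm2 (w - z)) *: (w - z).
have nv : nrm2 v = r.
  by rewrite nrm2Z ger0_norm ?divr_ge0 ?ltW// divfK ?gt_eqF.
have vD : edom (conj_fun h) (y + v).
  apply: Dr; rewrite -ball_normE/= opprD addrA subrr sub0r normrN.
  rewrite (le_lt_trans (normr_le_nrm2 _))// nv (lt_le_trans rm)//.
  by rewrite ge_min lexx orbT.
have := conj_ge (y + v) w; rewrite conj_fin// lee_fin => le1.
have nv1 : nrm2 v < r1 by rewrite nv (lt_le_trans rm)// ge_min lexx.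
have := le_trans (ler_norm _) (gr _ nv1); rewrite nv -/z => le2.
have : dotv v (w - z) = r * nrm2 (w - z).
  rewrite dotvZl -sqr_nrm2 expr2; field; exact: lt0r_neq0.
have dr : d <= e / 2 * r by rewrite ge_min lexx orbT.
rewrite dotvDl in le1; rewrite dotvDr dotvNr (dotvC v z) => vwz.
have : r * nrm2 (w - z) <= r * e by move: le1 le2 vwz dr wd; lra.
by rewrite ler_pM2l.
Qed.

(** Near-maximisers of the supremum defining [g y] converge to [z], and continuity of [h] at [z]
    passes their values to the limit. *)
Lemma conj_grad_attained : {for z, continuous h} ->
  forall w, dotv y w - h w <= dotv y z - h z.
Proof.
move=> ch w.
have yDy : edom (conj_fun h) y by exact: interior_subset yD.
have := conj_ge y w; rewrite conj_fin// lee_fin => /le_trans; apply.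
rewrite leNgt; apply/negP => kg.
pose e := (g y - (dotv y z - h z)) / 2.
have e0 : 0 < e by rewrite divr_gt0// subr_gt0.
have ck : {for z, continuous (fun v => dotv y v - h v)}.
  apply: (@continuousB _ _ _ (fun v => dotv y v)) => //.
  apply: dotv_continuous; [exact: cst_continuous|exact: id].
have /cvgrPdist_lt/(_ _ e0)/nbhs_ballP[r /= r0 kr] := ck.
have re0 : 0 < Num.min (r / 2) e by rewrite lt_min e0 divr_gt0.
have [v [vz gv]] := near_maximizer re0.
have /kr : ball z r v.
  rewrite -ball_normE/= distrC (le_lt_trans (normr_le_nrm2 _))//.
  rewrite (le_lt_trans vz)// gt_min; apply/orP; left; lra.
rewrite /= distrC => /(le_lt_trans (ler_norm _)).
have : Num.min (r / 2) e <= e by rewrite ge_min lexx orbT.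
move: gv kg; rewrite /e; lra.
Qed.

End attained.
End Conjugate.

(** * Weak convexity and inversion of the conjugate gradient *)

Section WeakConvexity.
Context {R : realType} (p : nat).
Implicit Types (f : 'cV[R]_p -> R) (x y z w : 'cV[R]_p).

Lemma gradN f z : differentiable f z -> grad (- f) z = - grad f z.
Proof. by move=> df; apply/colP => i; rewrite !mxE diffN. Qed.

(** On the segment the quadratic shift contributes [gam / 2 * t * (1 - t)] times the squared length;
    its [t ^+ 2] part is the error that [dotv_grad_ge] tolerates. That lemma bounds from below,
    hence its use for [- f]. *)
Lemma weakly_convex_grad_le gam f x y :
  weakly_convex gam f -> differentiable f x ->
  f x + dotv (grad f x) (y - x) - gam / 2 * dotv (y - x) (y - x) <= f y.
Proof.
move=> [gam0 cf] df; set w := y - x.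
have yE : y = x + w by rewrite /w addrC subrK.
clearbody w; subst y.
have : - (f (x + w) - f x + gam / 2 * dotv w w) <= dotv (grad (- f) x) w.
  apply: (@dotv_grad_ge _ _ _ _ _ _ (- (gam / 2 * dotv w w))).
    exact: differentiableN.
  move=> t /andP[t0 t1].
  have t01 : 0 <= t <= 1 by rewrite !ltW.
  have /= := cf (x + w) x t t01.
  have -> : t *: (x + w) + (1 - t) *: x = x + t *: w.
    by rewrite scalerDr scalerBl scale1r addrC addrA subrK.
  rewrite -[(- f) (x + t *: w)]/(- f (x + t *: w)) -[(- f) x]/(- f x).
  rewrite !sqr_nrm2 !dotvE (dotvC w x); lra.
rewrite gradN// dotvNl; lra.
Qed.

(** Fermat's rule at a maximiser: the one-sided condition in the directions [w] and [- w] yields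
    equality. *)
Lemma fenchel_gradE gam f y z :
  differentiable f z ->
  (forall w, dotv y w - (f w + gam / 2 * nrm2 w ^+ 2) <=
             dotv y z - (f z + gam / 2 * nrm2 z ^+ 2)) ->
  y = grad f z + gam *: z.
Proof.
move=> df yz.
have le_grad w : dotv y w - gam * dotv z w <= dotv (grad f z) w.
  apply: (@dotv_grad_ge _ _ _ _ _ _ (gam / 2 * dotv w w)) => // t t01.
  have := yz (z + t *: w); rewrite !sqr_nrm2 !dotvE (dotvC w z); lra.
apply: dotv_inj => w; have := le_grad w; have := le_grad (- w).
rewrite !dotvE; lra.
Qed.

(** The supremum is attained at [z], where Fermat's rule applies. This converts a dual variable into
    a primal gradient. *)
Lemma grad_conjE gam f y :
  (forall z, differentiable f z) ->
  (edom (conj_fun (fun z => f z + gam / 2 * nrm2 z ^+ 2)))° y ->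
  differentiable (fine \o conj_fun (fun z => f z + gam / 2 * nrm2 z ^+ 2)) y ->
  let z := grad (fine \o conj_fun (fun z => f z + gam / 2 * nrm2 z ^+ 2)) y in
  y = grad f z + gam *: z.
Proof.
move=> df yD dg z; apply: fenchel_gradE => // w.
apply: (@conj_grad_attained _ _ (fun z => f z + gam / 2 * nrm2 z ^+ 2)) => //.
apply: (@continuousD _ _ _ f).
  exact: differentiable_continuous.
apply: (@continuousM _ _ (cst (gam / 2)) (fun v => nrm2 v ^+ 2)).
  exact: cst_continuous.
rewrite (_ : (fun v : 'cV[R]_p => nrm2 v ^+ 2) = (fun v => dotv v v)); last first.
  by apply/funext => v; exact: sqr_nrm2.
by apply: (@dotv_continuous _ _ _ id id); exact: id.
Qed.

End WeakConvexity.

(** * Existence of the proximal point *)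

Section Prox.
Context {R : realType} (p : nat).
Implicit Types (phi : 'cV[R]_p -> \bar R) (x y z w : 'cV[R]_p).

(* The sublevel sets [B z] of the values attained on [K] form a filter base, and
   lower semicontinuity makes any of its cluster points a minimiser. *)
Lemma lsc_compact_min phi (K : set 'cV[R]_p) :
  lsc_efun phi -> compact K -> K !=set0 ->
  exists2 w, K w & forall y, K y -> (phi w <= phi y)%E.
Proof.
move=> lphi cK [x0 Kx0].
pose B z := [set y | K y /\ (phi y <= phi z)%E].
pose F := filter_from K B.
have FF : ProperFilter F.
  apply: filter_from_proper; last by move=> z Kz; exists z; split.
  apply: filter_from_filter; first by exists x0.
  move=> u v Ku Kv; have [uv|/ltW vu] := leP (phi u) (phi v).
    by exists u => // y [Ky yu]; split; split => //; exact: le_trans uv.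
  by exists v => // y [Ky yv]; split; split => //; exact: le_trans vu.
have FK : F K by exists x0 => // y [].
have [w [Kw clw]] := cK F FF FK.
exists w => // y Ky; rewrite leNgt; apply/negP => yw.
have [|v [[_ vy]]] := clw (B y) _ _ (lphi _ _ yw); first by exists y.
by rewrite /= ltNge vy.
Qed.

Lemma efun_fin phi x : proper_efun phi -> (phi x < +oo)%E ->
  phi x = (fine (phi x))%:E.
Proof. by move=> [/(_ x) nx _] xoo; rewrite fineK// fin_numE nx/= lt_eqF. Qed.

Lemma lsc_prox_objective (a : R) phi y : 0 < a -> proper_efun phi ->
  lsc_efun phi ->
  lsc_efun (fun w => a%:E * phi w + (nrm2 (y - w) ^+ 2 / 2)%:E)%E.
Proof.
move=> a0 [phiN _] lphi x c cx.
pose k w := nrm2 (y - w) ^+ 2 / 2.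
have ck : {for x, continuous k}.
  rewrite /k; apply: (@continuousM _ _ (fun w => nrm2 (y - w) ^+ 2)); last first.
    exact: cst_continuous.
  rewrite (_ : (fun w => nrm2 (y - w) ^+ 2) = (fun w => dotv (y - w) (y - w)));
    last first.
    by apply/funext => w; exact: sqr_nrm2.
  have cyx : {for x, continuous (fun w => y - w)}.
    by apply: (@continuousB _ _ _ (cst y)) => //; exact: cst_continuous.
  exact: dotv_continuous.
case: c cx => [c| |] cx; last 2 first.
- by rewrite ltNge leey in cx.
- apply: filterE => w; rewrite -/(k w).
  have := phiN w; case: (phi w) => [v _|_|//].
    by rewrite -EFinM -EFinD ltNyr.
  by rewrite gt0_muley ?lte_fin// addye.
(* A real [r] below [phi x] splits the strict inequality between the lower semicontinuous term and
   the continuous one; if [phi x] is infinite, any large [r] serves. *)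
have [r cr rx] : exists2 r : R, c < a * r + k x & (r%:E < phi x)%E.
  rewrite -/(k x) in cx; have := phiN x; move: cx.
  case: (phi x) => [v|_ _|//].
    rewrite -EFinM -EFinD lte_fin => cv _.
    exists (v - (a * v + k x - c) / 2 / a).
      rewrite mulrBr [a * (_ / a)]mulrC divfK ?gt_eqF//; lra.
    by rewrite lte_fin ltrBlDr ltrDl !divr_gt0// subr_gt0.
  exists ((c - k x) / a + 1); last by rewrite ltry.
  by rewrite mulrDr [a * (_ / a)]mulrC divfK ?gt_eqF//; lra.
have e0 : 0 < a * r + k x - c by rewrite subr_gt0.
have /cvgrPdist_lt/(_ _ e0) kn := ck.
apply: filterS2 (lphi _ _ rx) kn => w rw /(le_lt_trans (ler_norm _)) kxw.
rewrite -/(k w); apply: (@lt_le_trans _ _ (a%:E * r%:E + (k w)%:E)%E).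
  by rewrite -EFinM -EFinD lte_fin; move: kxw; lra.
by rewrite leeD2r// lee_pmul2l// ltW.
Qed.

(** Convexity makes [phi] decrease at most linearly away from [x0], so the quadratic dominates
    outside a large ball and a minimiser on that compact ball is global. *)
Lemma is_prox_ex (a : R) phi y : 0 < a -> proper_efun phi -> lsc_efun phi ->
  convex_efun phi -> exists w, is_prox a phi y w.
Proof.
move=> a0 pphi lphi cphi; have [phiN [x0 x0oo]] := pphi.
have lG := @lsc_prox_objective a phi y a0 pphi lphi.
have K1 r : 0 <= r -> [set w | `|w - x0| <= r] !=set0.
  by move=> r0; exists x0; rewrite /= subrr normr0.
have cb (r : R) : compact [set v | `|v - x0| <= r] := @cball_compact R p x0 r.
have [w0 w01 w0min] := lsc_compact_min lphi (cb 1) (K1 _ ler01).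
have f0E := efun_fin pphi x0oo; set f0 := fine _ in f0E.
have w0E : phi w0 = (fine (phi w0))%:E.
  by apply: efun_fin => //; rewrite (le_lt_trans (w0min x0 _))//= subrr normr0.
set c := fine (phi w0) in w0E.
have cf0 : c <= f0.
  by rewrite -lee_fin -w0E -f0E; apply: w0min; rewrite /= subrr normr0.
(* Pulling [x] back to the unit sphere around [x0], where [phi] is at least [c], and solving the
   convexity inequality for [phi x]. *)
have coercive x : 1 < `|x - x0| ->
    ((f0 - `|x - x0| * (f0 - c))%:E <= phi x)%E.
  set T := `|x - x0| => T1; have T0 : 0 < T by rewrite (lt_trans _ T1).
  have [xoo|] := ltP (phi x) +oo%E; last by apply: le_trans; rewrite leey.
  have xE := efun_fin pphi xoo; rewrite xE lee_fin.
  have Ti : 0 < T^-1 < 1 by rewrite invr_gt0 T0 invf_lt1.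
  have xT : `|T^-1 *: x + (1 - T^-1) *: x0 - x0| <= 1.
    have -> : T^-1 *: x + (1 - T^-1) *: x0 - x0 = T^-1 *: (x - x0).
      by rewrite scalerBl scale1r scalerBr addrA addrAC addrK.
    by rewrite normrZ gtr0_norm ?invr_gt0// mulVf ?gt_eqF.
  have := le_trans (w0min _ xT) (cphi x x0 T^-1 Ti).
  rewrite w0E xE f0E -!EFinM -EFinD lee_fin.
  rewrite -(ler_pM2l T0) mulrDr !mulrA mulrBr mulfV ?gt_eqF//.
  rewrite !mul1r mulr1; lra.
pose P := nrm2 (y - x0).
(* Beyond this radius [T * (T - 2 * P - 2 * a * (f0 - c))] is nonnegative, which says that the
   objective at [u] is at least its value at [x0]. The summand 1 gives [1 < T], as [coercive]
   demands. *)
pose rad := 1 + 2 * P + 2 * a * (f0 - c).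
have P0 : 0 <= P := nrm2_ge0 _.
have k0 : 0 <= a * (f0 - c) by rewrite mulr_ge0 ?subr_ge0// ltW.
have rad0 : 0 <= rad by rewrite /rad; lra.
have [w wr wmin] := lsc_compact_min lG (cb rad) (K1 _ rad0).
exists w => u; have [ur|ur] := leP `|u - x0| rad; first exact: wmin.
apply: (le_trans (wmin x0 _)); first by rewrite /= subrr normr0.
set T := `|u - x0| in ur.
have T1 : 1 < T by move: ur; rewrite /rad; lra.
have aphi : (a%:E * (f0 - T * (f0 - c))%:E <= a%:E * phi u)%E.
  by rewrite lee_pmul2l// coercive.
apply: (@le_trans _ _
  (a%:E * (f0 - T * (f0 - c))%:E + (nrm2 (y - u) ^+ 2 / 2)%:E)%E); last first.
  by rewrite leeD2r.
rewrite f0E -!EFinM -!EFinD lee_fin -/P.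
have TP : T - P <= nrm2 (y - u).
  have := nrm2D (u - y) (y - x0); rewrite subrKA -/P -(nrm2N (u - y)) opprB.
  have := normr_le_nrm2 (u - x0); rewrite -/T; lra.
have : (T - P) ^+ 2 <= nrm2 (y - u) ^+ 2.
  by rewrite ler_sqr// nnegrE ?nrm2_ge0//; move: ur; rewrite /rad; lra.
have : 0 <= T * (T - 2 * P - 2 * a * (f0 - c)).
  by rewrite mulr_ge0//; [lra|move: ur; rewrite /rad; lra].
lra.
Qed.
End Prox.

(** * Variational inequalities under strong convexity *)

Section StrongConvexity.
Context {R : realType} (p : nat).
Implicit Types (phi : 'cV[R]_p -> \bar R) (x y z w : 'cV[R]_p).

Lemma ler_small (a b c : R) : (forall t, 0 < t < 1 -> a <= b + t * c) -> a <= b.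
Proof.
move=> abc; apply/ler_addgt0Pr => e e0.
have c0 : 0 < `|c| + 1 by rewrite ltr_pwDr.
pose t := Num.min (1 / 2) (e / (`|c| + 1)).
have t0 : 0 < t by rewrite lt_min !divr_gt0.
have t1 : t < 1 by rewrite gt_min; apply/orP; left; lra.
apply: (le_trans (abc t _)); first by rewrite t0.
rewrite lerD2l; apply: (@le_trans _ _ (t * (`|c| + 1))).
  by rewrite ler_pM2l// (le_trans (ler_norm c))// lerDl.
by rewrite -ler_pdivlMr// ge_min lexx orbT.
Qed.

Lemma segment_sub x u t : t *: x + (1 - t) *: u = u + t *: (x - u).
Proof. by rewrite scalerBl scale1r scalerBr addrC -addrA [- _ + _]addrC. Qed.

Lemma strongly_convex_fin (s : R) phi x u (t : R) : proper_efun phi ->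
  strongly_convex_efun s phi -> (phi x < +oo)%E -> (phi u < +oo)%E ->
  0 < t < 1 ->
  (phi (u + t *: (x - u))%R < +oo)%E /\
  fine (phi (u + t *: (x - u))) <= t * fine (phi x) + (1 - t) * fine (phi u)
    - s / 2 * t * (1 - t) * dotv (x - u) (x - u).
Proof.
move=> pphi sphi xoo uoo t01.
have le : (phi (u + t *: (x - u))%R <= (t * fine (phi x) +
    (1 - t) * fine (phi u) - s / 2 * t * (1 - t) * dotv (x - u) (x - u))%:E)%E.
  have := sphi x u t t01; rewrite segment_sub sqr_nrm2.
  by rewrite (efun_fin pphi xoo) (efun_fin pphi uoo).
have oo : (phi (u + t *: (x - u))%R < +oo)%E by rewrite (le_lt_trans le)// ltry.
by split=> //; move: le; rewrite (efun_fin pphi oo) lee_fin.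
Qed.

Section prox.
Variables (s a : R) (phi : 'cV[R]_p -> \bar R).
Hypotheses (a0 : 0 < a) (pphi : proper_efun phi) (lphi : lsc_efun phi).
Hypotheses (cphi : convex_efun phi) (sphi : strongly_convex_efun s phi).

Lemma prox_is_prox y : is_prox a phi y (prox a phi y).
Proof. exact: (xgetPex 0 (is_prox_ex y a0 pphi lphi cphi)). Qed.

Lemma prox_fin y : (phi (prox a phi y) < +oo)%E.
Proof.
have [_ [x xoo]] := pphi.
rewrite ltey; apply/eqP => uoo; have := prox_is_prox y x.
by rewrite uoo (efun_fin pphi xoo) -EFinM -EFinD gt0_muley ?lte_fin// addye.
Qed.

(** Compare [u] with [u + t *: (x - u)], divide by [t] and let [t] tend to 0; the modulus [s]
    survives as the quadratic term. *)
Lemma prox_variational y x u : u = prox a phi y -> (phi x < +oo)%E ->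
  dotv (y - u) (x - u) + a * s / 2 * dotv (x - u) (x - u)
    <= a * (fine (phi x) - fine (phi u)).
Proof.
move=> uE xoo; have uoo : (phi u < +oo)%E by rewrite uE prox_fin.
apply: (@ler_small _ _ ((a * s + 1) / 2 * dotv (x - u) (x - u))) => t t01.
have [toO tle] := strongly_convex_fin pphi sphi xoo uoo t01.
have := prox_is_prox y (u + t *: (x - u)).
rewrite -uE (efun_fin pphi uoo) (efun_fin pphi toO) -!EFinM -!EFinD lee_fin.
have -> : y - (u + t *: (x - u)) = (y - u) - t *: (x - u).
  by rewrite opprD addrA.
move: t01 tle {toO}; move: (x - u) (y - u) => w v /andP[t0 t1] tle.
move/(ler_wpM2l (ltW a0)) : tle => tle.
rewrite !sqr_nrm2 !dotvE (dotvC w v) => ule.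
rewrite -(ler_pM2l t0); move: ule tle => /=; lra.
Qed.

End prox.

Lemma strongly_convex_min_growth (mu : R) phi x u : proper_efun phi ->
  strongly_convex_efun mu phi -> (forall y, (phi u <= phi y)%E) ->
  (phi x < +oo)%E ->
  mu / 2 * dotv (x - u) (x - u) <= fine (phi x) - fine (phi u).
Proof.
move=> pphi sphi umin xoo; have uoo := le_lt_trans (umin x) xoo.
apply: (@ler_small _ _ (mu / 2 * dotv (x - u) (x - u))) => t t01.
have [toO tle] := strongly_convex_fin pphi sphi xoo uoo t01.
have := umin (u + t *: (x - u)).
rewrite (efun_fin pphi uoo) (efun_fin pphi toO) lee_fin => ule.
move: t01 => /andP[t0 t1].
rewrite -(ler_pM2l t0); move: ule tle => /=; lra.
Qed.

Section composite.
Variables (F : 'cV[R]_p -> R) (G : 'cV[R]_p -> 'cV[R]_p) (L s : R).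
Variable phi : 'cV[R]_p -> \bar R.
Hypothesis descent : forall x y,
  F y <= F x + dotv (G x) (y - x) + L / 2 * dotv (y - x) (y - x).
Hypothesis Glip : forall x y, nrm2 (G x - G y) <= L * nrm2 (x - y).
Hypotheses (pphi : proper_efun phi) (lphi : lsc_efun phi).
Hypotheses (cphi : convex_efun phi) (s0 : 0 <= s).
Hypothesis sphi : strongly_convex_efun s phi.
Variable xs : 'cV[R]_p.
Hypothesis xsmin : forall y, ((F xs)%:E + phi xs <= (F y)%:E + phi y)%E.

Lemma minimizer_fin : (phi xs < +oo)%E.
Proof.
have [_ [x xoo]] := pphi; rewrite ltey; apply/eqP => xsoo.
by have := xsmin x; rewrite xsoo (efun_fin pphi xoo) -EFinD addey.
Qed.

(** Inequality form of the inclusion of [- G xs] in the subdifferential of [phi] at [xs]: along a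
    segment, [descent] bounds the growth of [F] up to order [t ^+ 2]. *)
Lemma minimizer_variational x : (phi x < +oo)%E ->
  - dotv (G xs) (x - xs) <= fine (phi x) - fine (phi xs).
Proof.
move=> xoo; have soo := minimizer_fin.
set K := dotv (x - xs) (x - xs).
apply: (@ler_small _ _ (L / 2 * K)) => t t01.
have [toO tle] := strongly_convex_fin pphi sphi xoo soo t01.
have := xsmin (xs + t *: (x - xs)).
rewrite (efun_fin pphi soo) (efun_fin pphi toO) -!EFinD lee_fin => sle.
have := descent xs (xs + t *: (x - xs)).
rewrite [_ + t *: _ - xs]addrC addKr dotvZl !dotvZr -/K => dle.
have K0 : 0 <= K := dotv_ge0 _.
move: t01 => /andP[t0 t1].
have sK : 0 <= s / 2 * K * t * (1 - t).
  by rewrite !mulr_ge0 ?divr_ge0 ?(ltW t0)// subr_ge0 ltW.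
rewrite -(ler_pM2l t0).
move: sle tle dle; rewrite -/K/=; lra.
Qed.

(** Adding the inequalities at the proximal point [u] and at [xs] bounds the squared norm of
    [u - xs] by its inner product with [(x - xs) - (G x - G xs)]. Hence [u] is within [1 + |L|]
    times the distance from [x] to [xs], and the triangle inequality adds one more. *)
Lemma natural_residual_le x :
  nrm2 (x - prox 1 phi (x - G x)) <= (2 + `|L|) * nrm2 (x - xs).
Proof.
set u := prox _ _ _.
have uoo : (phi u < +oo)%E := prox_fin (@ltr01 R) pphi lphi cphi _.
have := prox_variational (@ltr01 R) pphi lphi cphi sphi (erefl u) minimizer_fin.
rewrite !mul1r => h1; have h2 := minimizer_variational uoo.
have K0 : 0 <= s / 2 * dotv (xs - u) (xs - u).
  by rewrite mulr_ge0 ?dotv_ge0// divr_ge0.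
have hu : dotv (u - xs) (u - xs) <= dotv ((x - xs) - (G x - G xs)) (u - xs).
  have : dotv (x - G x - u) (xs - u) - dotv (G xs) (u - xs) <= 0.
    by move: h1 h2 K0; lra.
  rewrite !dotvE (dotvC xs u); lra.
have nu : nrm2 (u - xs) <= nrm2 (x - xs) + `|L| * nrm2 (x - xs).
  have [->|u0] := eqVneq (nrm2 (u - xs)) 0.
    by rewrite addr_ge0 ?mulr_ge0 ?nrm2_ge0.
  have {}u0 : 0 < nrm2 (u - xs) by rewrite lt_neqAle eq_sym u0 nrm2_ge0.
  rewrite -(ler_pM2r u0) -expr2 sqr_nrm2 (le_trans hu)//.
  rewrite (le_trans (CauchySchwarz_dotv _ _))// ler_pM2r//.
  rewrite (le_trans (nrm2D _ _))// nrm2N lerD2l (le_trans (Glip _ _))//.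
  by rewrite ler_wpM2r ?nrm2_ge0// ler_norm.
have := nrm2D (x - xs) (xs - u); rewrite addrA subrK -(nrm2N (xs - u)) opprB.
move: nu; lra.
Qed.

End composite.
End StrongConvexity.

(** * Uniform averages, independence of draws and histories *)

Section Mean.
Context {R : realType}.

Definition mean (T : finType) (X : T -> R) : R := #|T|%:R^-1 * \sum_t X t.

Section mean.
Variable T : finType.
Implicit Types (X Y : T -> R).

Lemma eq_mean X Y : X =1 Y -> mean X = mean Y.
Proof. by move=> XY; rewrite /mean (eq_bigr _ (fun t _ => XY t)). Qed.

Lemma meanD X Y : mean (fun t => X t + Y t) = mean X + mean Y.
Proof. by rewrite /mean big_split mulrDr. Qed.

Lemma meanZ (c : R) X : mean (fun t => c * X t) = c * mean X.
Proof. by rewrite /mean -mulr_sumr mulrCA. Qed.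

Lemma meanN X : mean (fun t => - X t) = - mean X.
Proof. by rewrite /mean sumrN mulrN. Qed.

Lemma mean_cst (c : R) : (0 < #|T|)%N -> mean (fun _ : T => c) = c.
Proof.
move=> T0; rewrite /mean sumr_const -[c *+ _]mulr_natl mulKf//.
by rewrite pnatr_eq0 -lt0n.
Qed.

Lemma ler_mean X Y : (forall t, X t <= Y t) -> mean X <= mean Y.
Proof.
by move=> XY; rewrite /mean ler_wpM2l ?invr_ge0 ?ler0n// ler_sum.
Qed.

Lemma mean_ge0 X : (forall t, 0 <= X t) -> 0 <= mean X.
Proof.
by move=> X0; rewrite /mean mulr_ge0 ?invr_ge0 ?ler0n// sumr_ge0.
Qed.

Lemma mean_sum (I : finType) (F : I -> T -> R) :
  mean (fun t => \sum_i F i t) = \sum_i mean (F i).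
Proof. by rewrite /mean exchange_big mulr_sumr. Qed.

Lemma mean_dotvr p (v : 'cV[R]_p) (u : T -> 'cV[R]_p) :
  mean (fun t => dotv v (u t)) = dotv v (#|T|%:R^-1 *: \sum_t u t).
Proof. by rewrite dotvZr dotv_sumr. Qed.

End mean.

(** Independence of the coordinates of a uniform function, by distributing the product over the
    sums. Setting all factors but one or two to 1 gives the marginals. *)
Lemma mean_prod (I T : finType) (F : I -> T -> R) :
  mean (fun k : {ffun I -> T} => \prod_i F i (k i)) = \prod_i mean (F i).
Proof.
by rewrite /mean big_split/= prodr_const exprVn card_ffun natrX -bigA_distr_bigA.
Qed.

Lemma mean_marginal (I T : finType) (F : T -> R) (i : I) : (0 < #|T|)%N ->
  mean (fun k : {ffun I -> T} => F (k i)) = mean F.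
Proof.
move=> T0.
have := mean_prod (fun j t => if j == i then F t else 1).
rewrite [RHS](bigD1 i)//= eqxx [X in _ * X]big1 ?mulr1 => [|j /negPf ji].
  move=> <-; apply: eq_mean => k.
  by rewrite (bigD1 i)//= eqxx big1 ?mulr1// => j /negPf ->.
by rewrite ji mean_cst.
Qed.

Lemma mean_marginal2 (I T : finType) (F G : T -> R) (i j : I) :
  (0 < #|T|)%N -> i != j ->
  mean (fun k : {ffun I -> T} => F (k i) * G (k j)) = mean F * mean G.
Proof.
move=> T0 ij.
have ji : (j == i) = false by rewrite eq_sym (negPf ij).
have := mean_prod (fun l t => if l == i then F t else if l == j then G t else 1).
rewrite [RHS](bigD1 i)//= eqxx [X in _ * X](bigD1 j) ?ji//= eqxx.
rewrite [X in _ * (_ * X)]big1 ?mulr1 => [|l /andP[/negPf li /negPf lj]].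
  move=> <-; apply: eq_mean => k.
  rewrite (bigD1 i)//= eqxx (bigD1 j) ?ji//= eqxx big1 ?mulr1//.
  by move=> l /andP[/negPf -> /negPf ->].
by rewrite li lj mean_cst.
Qed.

(** For the centred vectors [h i], the cross terms of distinct draws vanish by independence, leaving
    [b] equal diagonal terms; a variance is at most the second moment. *)
Lemma mean_sqr_average (N b p : nat) (g : 'I_N -> 'cV[R]_p) gbar :
  (0 < N)%N -> (0 < b)%N -> gbar = N%:R^-1 *: \sum_i g i ->
  mean (fun K : {ffun 'I_b -> 'I_N} =>
    nrm2 (gbar - b%:R^-1 *: \sum_(j < b) g (K j)) ^+ 2)
  <= b%:R^-1 * mean (fun i => nrm2 (g i) ^+ 2).
Proof.
move=> N0 b0 gbarE; have N0' : (0 < #|'I_N|)%N by rewrite card_ord.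
have bn0 : b%:R != 0 :> R by rewrite pnatr_eq0 -lt0n.
pose h i := gbar - g i.
have mean_h v : mean (fun i => dotv (h i) v) = 0.
  rewrite /h (eq_mean (fun i => dotvDl _ _ _)) meanD mean_cst//.
  rewrite (eq_mean (fun i => dotvNl _ _)) meanN (eq_mean (fun i => dotvC _ _)).
  by rewrite mean_dotvr card_ord -gbarE (dotvC v) subrr.
have mean_hh : mean (fun i => dotv (h i) (h i)) <= mean (fun i => nrm2 (g i) ^+ 2).
  rewrite [leLHS](_ : _ = mean (fun i => nrm2 (g i) ^+ 2) - dotv gbar gbar).
    by rewrite lerBlDr lerDl dotv_ge0.
  rewrite (@eq_mean _ _ (fun i => dotv gbar gbar + (-2 * dotv gbar (g i)
      + nrm2 (g i) ^+ 2))); last first.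
    by move=> i; rewrite sqr_nrm2 /h !dotvE (dotvC (g i)); ring.
  rewrite meanD mean_cst// meanD meanZ mean_dotvr card_ord -gbarE; ring.
have -> : (fun K : {ffun 'I_b -> 'I_N} =>
    nrm2 (gbar - b%:R^-1 *: \sum_(j < b) g (K j)) ^+ 2) =
  (fun K => b%:R^-1 ^+ 2 * \sum_(j < b) \sum_(l < b) dotv (h (K j)) (h (K l))).
  apply/funext => K.
  have -> : gbar - b%:R^-1 *: \sum_(j < b) g (K j) = b%:R^-1 *: \sum_(j < b) h (K j).
    rewrite sumrB sumr_const card_ord scalerBr -[gbar *+ b]scaler_nat scalerA mulVf//.
    by rewrite scale1r.
  rewrite sqr_nrm2 dotvZl dotvZr mulrA -expr2 dotv_suml; congr (_ * _).
  by apply: eq_bigr => j _; rewrite dotv_sumr.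
rewrite meanZ mean_sum (eq_bigr (fun=> mean (fun i => dotv (h i) (h i)))).
  rewrite sumr_const card_ord -[mean _ *+ b]mulr_natl expr2 mulrA mulfVK//.
  by rewrite ler_wpM2l// invr_ge0.
move=> j _; rewrite mean_sum (bigD1 j)//= big1 ?addr0 => [|l lj].
  exact: (mean_marginal (fun i => dotv (h i) (h i))).
rewrite /dotv mean_sum big1// => c _.
rewrite (mean_marginal2 (fun i => h i c 0) (fun i => h i c 0))//; last first.
  by rewrite eq_sym.
have := mean_h (delta_mx c 0); under eq_mean do rewrite dotv_delta.
by move=> ->; rewrite mul0r.
Qed.

(** Histories are read in reverse, so the newest draw, at index [ord_max], becomes the head; [ext]
    is the bijection that appends it. *)
Lemma ExpS (N b T : nat) (X : seq (batch N b) -> R) :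
  Exp R N b T.+1 X = Exp R N b T (fun hr => mean (fun K => X (K :: hr))).
Proof.
have cE : #|{ffun 'I_T.+1 -> batch N b}| =
    (#|{ffun 'I_T -> batch N b}| * #|{: batch N b}|)%N.
  by rewrite [LHS]card_ffun [X in (X * _)%N]card_ffun !card_ord expnS mulnC.
rewrite /Exp /mean -mulr_sumr mulrA -invfM -natrM -cE; congr (_ * _).
rewrite pair_bigA/=.
pose ext (wK : {ffun 'I_T -> batch N b} * batch N b) : {ffun 'I_T.+1 -> batch N b} :=
  [ffun i => if unlift ord_max i is Some j then wK.1 j else wK.2].
have extE w K : rev (fgraph (ext (w, K))) = K :: rev (fgraph w).
  rewrite !fgraph_codom /= /codom /image_mem enum_ordSr map_rcons rev_rcons.
  rewrite ffunE unlift_none/= -map_comp; congr (_ :: rev _).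
  apply: eq_map => i /=; rewrite ffunE.
  by have -> : widen_ord (leqnSn T) i = lift ord_max i
    by [apply: val_inj; rewrite /= /bump leqNgt ltn_ord]; rewrite liftK.
rewrite (reindex ext)/=; last first.
  exists (fun w => ([ffun i => w (lift ord_max i)], w ord_max)) => [[w K] _|w _].
    rewrite /ext; congr (_, _); last by rewrite ffunE unlift_none.
    by apply/ffunP => i; rewrite !ffunE liftK.
  apply/ffunP => i; rewrite ffunE /=.
  by case: unliftP => [j ->|->]; rewrite ?ffunE.
by apply: eq_bigr => -[w K] _ /=; congr X; exact: extE.
Qed.

Lemma eq_Exp (N b T : nat) (X Y : seq (batch N b) -> R) :
  (forall hr, size hr = T -> X hr = Y hr) -> Exp R N b T X = Exp R N b T Y.
Proof.
move=> XY; rewrite /Exp; congr (_ * _); apply: eq_bigr => w _; apply: XY.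
by rewrite size_rev size_tuple card_ord.
Qed.

Lemma ler_Exp (N b T : nat) (X Y : seq (batch N b) -> R) :
  (forall hr, size hr = T -> X hr <= Y hr) -> Exp R N b T X <= Exp R N b T Y.
Proof.
move=> XY; rewrite /Exp ler_wpM2l ?invr_ge0 ?ler0n//; apply: ler_sum => w _.
by apply: XY; rewrite size_rev size_tuple card_ord.
Qed.

Lemma ExpD (N b T : nat) (X Y : seq (batch N b) -> R) :
  Exp R N b T (fun hr => X hr + Y hr) = Exp R N b T X + Exp R N b T Y.
Proof. exact: meanD. Qed.

Lemma ExpZ (N b T : nat) (c : R) (X : seq (batch N b) -> R) :
  Exp R N b T (fun hr => c * X hr) = c * Exp R N b T X.
Proof. exact: meanZ. Qed.

End Mean.

(** * The finite sum, its mini-batch estimates and the one-step inequality *)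

Section FiniteSum.
Context {R : realType} (N n : nat) (m : 'I_N -> nat).
Variables (A : forall i : 'I_N, 'M[R]_(m i, n)) (f : forall i, 'cV[R]_(m i) -> R).
Variables (gam Li : 'I_N -> R).
Arguments f : clear implicits.
Hypothesis N0 : (0 < N)%N.
Hypothesis fA1 : forall i, Lsmooth (Li i) (f i) /\ weakly_convex (gam i) (f i).
Implicit Types (x y w : 'cV[R]_n) (i : 'I_N).

Local Notation F := (fsum R N n m A f).
Local Notation dF := (gradf R N n m A f).
Local Notation Lb := (Lbar R N n m A Li).

Definition grad_comp i x : 'cV[R]_n := (A i)^T *m grad (f i) (A i *m x).
Definition quad_comp i w : R := gam i * dotv (A i *m w) (A i *m w).

Lemma quad_comp_ge0 i w : 0 <= quad_comp i w.
Proof. by rewrite mulr_ge0 ?dotv_ge0//; have [_ []] := fA1 i. Qed.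

Lemma comp_grad_le i x y :
  f i (A i *m x) + dotv (grad_comp i x) (y - x) - quad_comp i (y - x) / 2
    <= f i (A i *m y).
Proof.
have [[df _] wc] := fA1 i.
have := weakly_convex_grad_le (A i *m y) wc (df (A i *m x)).
rewrite -mulmxBr /grad_comp /quad_comp [dotv (_^T *m _) _]dotvC.
rewrite -dotv_mulmx [dotv (A i *m _) (grad _ _)]dotvC; lra.
Qed.

Lemma Lbar_ge0 : 0 <= Lb.
Proof. by rewrite /Lbar; elim/big_rec : _ => // i c _ c0; rewrite le_max c0 orbT. Qed.

Lemma grad_comp_lip i x y :
  nrm2 (grad_comp i x - grad_comp i y) <= Lb * nrm2 (x - y).
Proof.
have [[_ lip] _] := fA1 i.
rewrite /grad_comp -mulmxBr (le_trans (nrm2_mulmxT _ _))//.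
have := lip (A i *m x) (A i *m y); rewrite -mulmxBr => le1.
have le2 := nrm2_mulmx (A i) (x - y).
have A0 := opnorm_ge0 (A i); have nA := nrm2_ge0 (A i *m (x - y)).
have nxy := nrm2_ge0 (x - y).
(* The sign of [Li i] is not given. A negative value makes the Lipschitz bound nonpositive, while
   [Lbar] is nonnegative because its maximum is seeded with 0. *)
have [L0|L0] := leP 0 (Li i).
  have LiLb : Li i * opnorm (A i) ^+ 2 <= Lb.
    by rewrite /Lbar; apply: (@le_bigmax _ _ _ 0 (fun i => Li i * opnorm (A i) ^+ 2)).
  apply: (@le_trans _ _ (opnorm (A i) * (Li i * (opnorm (A i) * nrm2 (x - y))))).
    by rewrite ler_wpM2l// (le_trans le1)// ler_wpM2l.
  rewrite (_ : _ * (_ * _) = Li i * opnorm (A i) ^+ 2 * nrm2 (x - y)); last by ring.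
  by rewrite ler_wpM2r.
apply: (@le_trans _ _ 0); last by rewrite mulr_ge0 ?Lbar_ge0.
rewrite -(mulr0 (opnorm (A i))) ler_wpM2l// (le_trans le1)//.
by rewrite nmulr_rle0.
Qed.

Lemma gradfE x : dF x = N%:R^-1 *: \sum_i grad_comp i x.
Proof. by []. Qed.

Lemma dotv_MN w : dotv w (MN R N n m A gam *m w) = mean (fun i => quad_comp i w).
Proof.
rewrite /MN -scalemxAl dotvZr /mean card_ord mulmx_suml dotv_sumr.
congr (_ * _); apply: eq_bigr => i _.
by rewrite -scalemxAl dotvZr /quad_comp -mulmxA dotv_mulmx.
Qed.

Lemma fsum_descent (L : R) : (forall x y, nrm2 (dF x - dF y) <= L * nrm2 (x - y)) ->
  forall x y, F y <= F x + dotv (dF x) (y - x) + L / 2 * dotv (y - x) (y - x).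
Proof.
move=> dFlip x y; have -> : y = x + (y - x) by rewrite addrC subrK.
move: (y - x) => w; rewrite [x + w - x]addrC addKr.
pose h (t : R) := F (x + t *: w).
have hd (t : R) : is_derive t (1 : R) h (dotv (dF (x + t *: w)) w).
  pose hi i (s : R) := f i (A i *m x + s *: (A i *m w)).
  have -> : h = N%:R^-1 \*: \sum_i hi i.
    apply/funext => s; rewrite /h /fsum fct_sumE; congr (_ * _).
    by apply: eq_bigr => i _; rewrite mulmxDr -scalemxAr.
  have hid i : is_derive t (1 : R) (hi i)
      (dotv (grad (f i) (A i *m x + t *: (A i *m w))) (A i *m w)).
    by apply: is_derive_line; have [[]] := fA1 i.
  apply: is_derive_eq.
  rewrite /gradf dotvZl dotv_suml; congr (_ * _); apply: eq_bigr => i _.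
  by rewrite mulmxDr -scalemxAr [RHS]dotvC -dotv_mulmx dotvC.
have hK (t : R) : 0 < t < 1 ->
    dotv (dF (x + t *: w)) w - dotv (dF (x + 0 *: w)) w <= L * dotv w w * t.
  move=> /andP[t0 _]; rewrite scale0r addr0 -dotvNl -dotvDl.
  rewrite (le_trans (CauchySchwarz_dotv _ _))//.
  apply: (@le_trans _ _ (L * (t * nrm2 w) * nrm2 w)).
    rewrite ler_wpM2r ?nrm2_ge0// (le_trans (dFlip _ _))//.
    by rewrite addrAC subrr add0r nrm2Z gtr0_norm.
  by rewrite -sqr_nrm2 le_eqVlt; apply/orP; left; apply/eqP; ring.
have := descent_line hd hK; rewrite /h !scale0r addr0 scale1r.
lra.
Qed.

Section batch.
Variables (b : nat) (alpha : R).
Hypotheses (b0 : (0 < b)%N) (alpha0 : 0 < alpha).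
Local Notation batch := (batch N b).
Implicit Types K : batch.
Local Notation dFS := (gradfS R N n m A f b).
Local Notation MK := (MS R N n m A gam b).

Definition fS K x : R := b%:R^-1 * \sum_(j < b) f (K j) (A (K j) *m x).
Definition QS K w : R := dotv w (MK K *m w).

Lemma QSE K w : QS K w = b%:R^-1 * \sum_(j < b) quad_comp (K j) w.
Proof.
rewrite /QS /MS -scalemxAl dotvZr mulmx_suml dotv_sumr.
congr (_ * _); apply: eq_bigr => i _.
by rewrite -scalemxAl dotvZr /quad_comp -mulmxA dotv_mulmx.
Qed.

Lemma MS_sym K w y : dotv w (MK K *m y) = dotv y (MK K *m w).
Proof.
rewrite /MS -!scalemxAl !dotvZr !mulmx_suml !dotv_sumr.
congr (_ * _); apply: eq_bigr => i _.
by rewrite -!scalemxAl !dotvZr -!mulmxA -!dotv_mulmx dotvC.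
Qed.

Lemma fS_grad_le K x y :
  fS K x + dotv (dFS K x) (y - x) - QS K (y - x) / 2 <= fS K y.
Proof.
rewrite QSE /gradfS dotvZl dotv_suml /fS -mulrA -mulrDr -mulrBr.
rewrite ler_wpM2l ?invr_ge0// mulr_suml -big_split -sumrB /=.
by apply: ler_sum => j _; exact: comp_grad_le.
Qed.

Lemma mean_batch_average (X : 'I_N -> R) :
  mean (fun K => b%:R^-1 * \sum_(j < b) X (K j)) = mean X.
Proof.
rewrite meanZ mean_sum (eq_bigr (fun=> mean X)) => [|j _].
  rewrite sumr_const card_ord -[mean X *+ b]mulr_natl mulKf//.
  by rewrite pnatr_eq0 -lt0n.
by rewrite mean_marginal// card_ord.
Qed.

Lemma mean_fS x : mean (fun K => fS K x) = F x.
Proof.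
have := mean_batch_average (fun i => f i (A i *m x)).
by rewrite {2}/mean card_ord.
Qed.

Lemma mean_QS w : mean (fun K => QS K w) = dotv w (MN R N n m A gam *m w).
Proof. by rewrite (eq_mean (fun K => QSE K w))
  (mean_batch_average (fun i => quad_comp i w)) dotv_MN. Qed.

Lemma mean_gradfS x w : mean (fun K => dotv (dFS K x) w) = dotv (dF x) w.
Proof.
have -> : (fun K => dotv (dFS K x) w) =
    (fun K => b%:R^-1 * \sum_(j < b) dotv (grad_comp (K j) x) w).
  by apply/funext => K; rewrite dotvZl dotv_suml.
rewrite (mean_batch_average (fun i => dotv (grad_comp i x) w)).
by rewrite gradfE dotvZl dotv_suml /mean card_ord.
Qed.

(** The variance bound applied to the increments [g i], each at most [Lb * nrm2 (x - y)]. *)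
Lemma mean_grad_deviation x y :
  mean (fun K => nrm2 ((dF x - dF y) - (dFS K x - dFS K y)) ^+ 2)
    <= Lb ^+ 2 / b%:R * nrm2 (x - y) ^+ 2.
Proof.
pose g i := grad_comp i x - grad_comp i y.
have gE : dF x - dF y = N%:R^-1 *: \sum_i g i by rewrite sumrB scalerBr.
apply: (@le_trans _ _ (b%:R^-1 * mean (fun i => nrm2 (g i) ^+ 2))).
  have := mean_sqr_average N0 b0 gE.
  by under [X in X <= _ -> _]eq_mean do rewrite sumrB scalerBr.
rewrite mulrAC [leRHS]mulrC ler_wpM2l ?invr_ge0//.
apply: (@le_trans _ _ (mean (fun _ : 'I_N => Lb ^+ 2 * nrm2 (x - y) ^+ 2))).
  apply: ler_mean => i; rewrite -exprMn ler_sqr ?nnegrE ?mulr_ge0 ?Lbar_ge0 ?nrm2_ge0//.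
  exact: grad_comp_lip.
by rewrite mean_cst ?card_ord.
Qed.

(** Here [fu] and [fxs] stand for the values of [phi] at [u] and [xs]. The five inequalities are
    added with weight [2 * alpha], the proximal one with weight 2. The two weak-convexity errors and
    the cross term from the regulariser complete a square, leaving [QS K (x - xs)]. *)
Lemma deterministic_step K (L s mu : R) x u v r xs fu fxs :
  dotv (x - alpha *: (dFS K u + MK K *m u + r) - alpha *: (v - MK K *m x) - u) (xs - u)
    + alpha * s / 2 * dotv (xs - u) (xs - u) <= alpha * (fxs - fu) ->
  F u <= F x + dotv (dF x) (u - x) + L / 2 * dotv (u - x) (u - x) ->
  mu / 2 * dotv (u - xs) (u - xs) <= F u + fu - (F xs + fxs) ->
  (1 + alpha * (s + mu)) * dotv (u - xs) (u - xs) <=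
  dotv (x - xs) (x - xs) + alpha * QS K (x - xs)
  - (1 - alpha * L) * dotv (u - x) (u - x)
  + 2 * alpha * (F x - fS K x + (fS K xs - F xs)
     + dotv (dF x - dFS K x - v) (u - x) + dotv v (xs - x) + dotv r (xs - u)).
Proof.
have := fS_grad_le K u xs; have := fS_grad_le K x u.
rewrite /QS.
have -> : x - xs = - (u - x) - (xs - u) by rewrite !opprB subrKA.
have -> : xs - x = (u - x) + (xs - u) by rewrite [RHS]addrC subrKA.
rewrite -(opprB xs u).
have -> : x - alpha *: (dFS K u + MK K *m u + r) - alpha *: (v - MK K *m x) - u
    = - (u - x) - alpha *: (dFS K u + MK K *m (u - x) + r + v).
  rewrite mulmxBr; apply/colP => c; rewrite !mxE; ring.
(* In terms of these two increments every quantity expands into inner products that linear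
   arithmetic treats as atoms. *)
move: (u - x) (xs - u) => w1 w2.
rewrite !(mulmxDr, mulmxN).
have := MS_sym K w2 w1; move: (MK K *m w1) (MK K *m w2) => n1 n2.
move: (dFS K u) (dFS K x) (dF x) => gu gx dx.
rewrite !dotvE (dotvC w2 w1) (dotvC n1 w2) => ->.
move=> /(ler_wpM2l (ltW alpha0)) h1 /(ler_wpM2l (ltW alpha0)) h2 h3.
move=> /(ler_wpM2l (ltW alpha0)) h4 /(ler_wpM2l (ltW alpha0)) h5.
lra.
Qed.

End batch.
End FiniteSum.

(** * Dual residuals and the one-step inequality in the mean *)

Section AveragedStep.
Context {R : realType} (N n : nat) (m : 'I_N -> nat).
Variables (A : forall i : 'I_N, 'M[R]_(m i, n)) (f : forall i, 'cV[R]_(m i) -> R).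
Variables (gam Li : 'I_N -> R).
Arguments f : clear implicits.
Hypothesis N0 : (0 < N)%N.
Hypothesis fA1 : forall i, Lsmooth (Li i) (f i) /\ weakly_convex (gam i) (f i).
Variables (b : nat) (alpha L s mu : R) (phi : 'cV[R]_n -> \bar R) (xs : 'cV[R]_n).
Hypotheses (b0 : (0 < b)%N) (alpha0 : 0 < alpha).
Implicit Types (x y w u xt : 'cV[R]_n) (K : batch N b).

Local Notation F := (fsum R N n m A f).
Local Notation dF := (gradf R N n m A f).
Local Notation Lb := (Lbar R N n m A Li).
Local Notation dFS := (gradfS R N n m A f b).
Local Notation MK := (MS R N n m A gam b).
Local Notation proxa := (prox alpha phi).

Definition residual_const : R := \sum_i opnorm (A i) * (`|Li i| + gam i).

Lemma residual_const_ge0 : 0 <= residual_const.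
Proof.
apply: sumr_ge0 => i _; have [_ [g0 _]] := fA1 i.
by rewrite mulr_ge0 ?opnorm_ge0// addr_ge0.
Qed.

(** By [grad_conjE] each dual component is the gradient of [fhat] at [z j], so the residual averages
    differences of such gradients at [z j] and [A (K j) *m u], and these gradients are Lipschitz. *)
Lemma dual_residual_le K (xi : dualv R N m b) u (V : R) :
  (forall i, ess_differentiable (fhat_conj R N m f gam i)) ->
  (forall j, Dom R N m f gam (K j) (xi j (K j))) ->
  Num.sqrt (\sum_(j < b) nrm2 (grad_fhat_conj R N m f gam (K j) (xi j (K j))
    - A (K j) *m u) ^+ 2) <= V ->
  nrm2 (ASt R N n m A b K xi - (dFS K u + MK K *m u)) <= residual_const * V.
Proof.
move=> ediff xiD VV.
pose z j := grad_fhat_conj R N m f gam (K j) (xi j (K j)).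
have zV j : nrm2 (z j - A (K j) *m u) <= V.
  apply: le_trans VV; rewrite -(ger0_norm (nrm2_ge0 _)) -sqrtr_sqr ler_sqrt.
    by rewrite (bigD1 j)//= lerDl sumr_ge0// => k _; rewrite sqr_ge0.
  by rewrite sumr_ge0// => k _; rewrite sqr_ge0.
pose g j := grad (f (K j)) (z j) - grad (f (K j)) (A (K j) *m u)
  + gam (K j) *: (z j - A (K j) *m u).
have -> : ASt R N n m A b K xi - (dFS K u + MK K *m u) =
    b%:R^-1 *: \sum_(j < b) (A (K j))^T *m g j.
  rewrite /ASt /gradfS /MS -scalemxAl -scalerDr -scalerBr; congr (_ *: _).
  rewrite mulmx_suml -big_split -sumrB; apply: eq_bigr => j _ /=.
  have -> : xi j (K j) = grad (f (K j)) (z j) + gam (K j) *: z j.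
    apply: (grad_conjE _ (xiD j)); first by have [[]] := fA1 (K j).
    by have [_ [+ _]] := ediff (K j); apply; exact: xiD.
  rewrite -scalemxAl -mulmxA scalemxAr -mulmxDr -mulmxBr; congr (_ *m _).
  by rewrite /g scalerBr opprD addrACA.
have gV j : nrm2 ((A (K j))^T *m g j) <= residual_const * V.
  have [[_ lip] [g0 _]] := fA1 (K j).
  have A0 := opnorm_ge0 (A (K j)).
  have V0 : 0 <= V := le_trans (nrm2_ge0 _) (zV j).
  apply: (@le_trans _ _ (opnorm (A (K j)) * (`|Li (K j)| + gam (K j)) * V)).
    apply: (le_trans (nrm2_mulmxT _ _)); rewrite -mulrA; apply: (ler_wpM2l A0).
    apply: (le_trans (nrm2D _ _)); rewrite mulrDl; apply: lerD.
      apply: (le_trans (lip _ _)).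
      apply: (le_trans (ler_wpM2r (nrm2_ge0 _) (ler_norm _))).
      exact: (ler_wpM2l (normr_ge0 _) (zV j)).
    rewrite nrm2Z ger0_norm; last exact: g0.
    exact: (ler_wpM2l g0 (zV j)).
  rewrite ler_wpM2r// /residual_const (bigD1 (K j))//= lerDl.
  apply: sumr_ge0 => i _; have [_ [gi0 _]] := fA1 i.
  by rewrite mulr_ge0 ?opnorm_ge0// addr_ge0.
rewrite nrm2Z ger0_norm ?invr_ge0// -[leRHS](@mulKf _ (b%:R)); last first.
  by rewrite pnatr_eq0 -lt0n.
rewrite ler_wpM2l ?invr_ge0// (le_trans (nrm2_sum _))//.
rewrite (le_trans (ler_sum _ (fun j _ => gV j)))// sumr_const card_ord.
by rewrite mulr_natl.
Qed.

Hypotheses (pphi : proper_efun phi) (lphi : lsc_efun phi).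
Hypotheses (cphi : convex_efun phi) (sphi : strongly_convex_efun s phi).
Hypothesis dFlip : forall x y, nrm2 (dF x - dF y) <= L * nrm2 (x - y).
Hypothesis mu_psi : strongly_convex_efun mu (psi R N n m A f phi).
Hypothesis xsmin : forall y, (psi R N n m A f phi xs <= psi R N n m A f phi y)%E.
Hypothesis MNle : forall x,
  mu * dotv x x <= s * dotv x x - dotv x (MN R N n m A gam *m x).

Lemma psi_fin x : (phi x < +oo)%E ->
  (psi R N n m A f phi x < +oo)%E /\
  fine (psi R N n m A f phi x) = F x + fine (phi x).
Proof.
by move=> xoo; rewrite /psi (efun_fin pphi xoo) -EFinD ltry.
Qed.

Lemma proper_psi : proper_efun (psi R N n m A f phi).
Proof.
have [phiN [x xoo]] := pphi; split=> [y|]; last first.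
  by exists x; have [] := psi_fin xoo.
by rewrite /psi; have := phiN y; case: (phi y).
Qed.

Lemma prox_step K x v r u :
  u = proxa (x - alpha *: (dFS K u + MK K *m u + r) - alpha *: (v - MK K *m x)) ->
  (1 + alpha * (s + mu)) * dotv (u - xs) (u - xs) <=
  dotv (x - xs) (x - xs) + alpha * QS A gam K (x - xs)
  - (1 - alpha * L) * dotv (u - x) (u - x)
  + 2 * alpha * (F x - fS A f K x + (fS A f K xs - F xs)
     + dotv (dF x - dFS K x - v) (u - x) + dotv v (xs - x) + dotv r (xs - u)).
Proof.
move=> uE.
have xsoo : (phi xs < +oo)%E := minimizer_fin pphi xsmin.
have uoo : (phi u < +oo)%E by rewrite uE; exact: prox_fin.
have [psiu psiuE] := psi_fin uoo; have [_ psisE] := psi_fin xsoo.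
have h1 := prox_variational alpha0 pphi lphi cphi sphi uE xsoo.
have h2 := fsum_descent fA1 dFlip x u.
apply: (deterministic_step fA1 alpha0 h1 h2).
by rewrite -psiuE -psisE; exact: (strongly_convex_min_growth proper_psi).
Qed.

(* Young's inequality with the balancing parameter [c k Lb / 2], which degenerates
   when [Lb = 0]; there any small parameter does. *)
Lemma mean_cross_term (w : batch N b -> 'cV[R]_n) x y (k : nat) (c : R) :
  (0 < k)%N -> c = Num.sqrt (2 / b%:R) ->
  mean (fun K => 2 * dotv ((dF x - dF y) - (dFS K x - dFS K y)) (w K)) <=
  c * k%:R * Lb / 2 * mean (fun K => dotv (w K) (w K))
  + c * Lb / k%:R * dotv (x - y) (x - y) :> R.
Proof.
move=> k0 cE.
have kR : 0 < k%:R :> R by rewrite ltr0n.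
have bR : 0 < b%:R :> R by rewrite ltr0n.
have c0 : 0 < c by rewrite cE sqrtr_gt0 divr_gt0.
have c2 : c ^+ 2 = 2 / b%:R by rewrite cE sqr_sqrtr// divr_ge0 ?ltW.
have Dle : mean (fun K => nrm2 ((dF x - dF y) - (dFS K x - dFS K y)) ^+ 2)
    <= Lb ^+ 2 / b%:R * nrm2 (x - y) ^+ 2 by exact: mean_grad_deviation.
set D := fun K => (dF x - dF y) - (dFS K x - dFS K y).
have young t : 0 < t -> mean (fun K => 2 * dotv (D K) (w K)) <=
    t^-1 * (Lb ^+ 2 / b%:R * nrm2 (x - y) ^+ 2)
    + t * mean (fun K => dotv (w K) (w K)).
  move=> t0; apply: (@le_trans _ _
      (mean (fun K => t^-1 * nrm2 (D K) ^+ 2 + t * dotv (w K) (w K)))).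
    apply: ler_mean => K; rewrite sqr_nrm2 -(ler_pM2l t0) mulrDr mulVKf ?gt_eqF//.
    have := mulr_dotv_le 1 t (D K) (w K); rewrite expr1n; lra.
  by rewrite meanD !meanZ lerD2r ler_wpM2l// invr_ge0 ltW.
have := Lbar_ge0 A Li; rewrite le_eqVlt => /predU1P[Lb0|Lb0].
  rewrite -Lb0 !(mulr0, mul0r) addr0.
  apply: (@ler_small _ _ _ (mean (fun K => dotv (w K) (w K)))) => t /andP[t0 _].
  have := young t t0; rewrite -Lb0 expr0n !(mulr0, mul0r) add0r.
  exact.
have t0 : 0 < c * k%:R * Lb / 2 by rewrite !(divr_gt0, mulr_gt0).
rewrite (le_trans (young _ t0))// addrC lerD2l sqr_nrm2 mulrA ler_wpM2r ?dotv_ge0//.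
rewrite le_eqVlt; apply/orP; left; apply/eqP.
have -> : b%:R^-1 = c ^+ 2 / 2 by rewrite c2; field; exact: lt0r_neq0.
by field; rewrite !lt0r_neq0.
Qed.

(** As [x], [xt] and [xs] are fixed while the batch varies, the terms in [fS] and the correction
    tested against [xs - x] average to zero. The iterate [u K] depends on the batch, so the gradient
    noise tested against [u K - x] remains and goes to [mean_cross_term]. *)
Lemma mean_step (u r : batch N b -> 'cV[R]_n) x xt (e : R) (k : nat) (c : R) :
  (0 < k)%N -> c = Num.sqrt (2 / b%:R) -> 0 <= e ->
  (forall K, u K = proxa (x - alpha *: (dFS K (u K) + MK K *m u K + r K)
      - alpha *: ((dF xt - dFS K xt) - MK K *m x))) ->
  (forall K, nrm2 (r K) <= e * nrm2 (xt - xs)) ->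
  (1 + alpha * (s + mu)) * mean (fun K => dotv (u K - xs) (u K - xs)) <=
  (1 + alpha * (s - mu)) * dotv (x - xs) (x - xs)
  - (1 - alpha * L - alpha * (c * k%:R * Lb / 2)) *
    mean (fun K => dotv (u K - x) (u K - x))
  + alpha * (c * Lb / k%:R) * dotv (x - xt) (x - xt)
  + alpha * e * (dotv (xt - xs) (xt - xs) +
                 mean (fun K => dotv (u K - xs) (u K - xs))) :> R.
Proof.
move=> k0 cE e0 uE re.
pose a K := dotv (u K - xs) (u K - xs).
pose d K := dotv (u K - x) (u K - x).
pose D K := (dF x - dF xt) - (dFS K x - dFS K xt).
pose v K := dF xt - dFS K xt.
have step K : (1 + alpha * (s + mu)) * a K <= dotv (x - xs) (x - xs)
    + (alpha * QS A gam K (x - xs) + (- (1 - alpha * L) * d K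
    + (2 * alpha * (F x + - fS A f K x) + (2 * alpha * (fS A f K xs + - F xs)
    + (alpha * (2 * dotv (D K) (u K - x)) + (2 * alpha * dotv (v K) (xs - x)
    + alpha * e * (dotv (xt - xs) (xt - xs) + a K))))))).
  have := @prox_step K x (v K) (r K) (u K) (uE K).
  have -> : dF x - dFS K x - v K = D K.
    rewrite /D /v; move: (dF x) (dFS K x) (dF xt) (dFS K xt) => p1 p2 p3 p4.
    by apply/colP => i; rewrite !mxE; ring.
  have : 2 * dotv (r K) (xs - u K) <= e * (dotv (xt - xs) (xt - xs) + a K).
    apply: (@le_trans _ _ (2 * (e * nrm2 (xt - xs) * nrm2 (u K - xs)))).
      rewrite ler_pM2l// (le_trans (CauchySchwarz_dotv _ _))//.
      by rewrite -(nrm2N (xs - u K)) opprB ler_wpM2r ?nrm2_ge0.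
    rewrite mulrCA -mulrA ler_wpM2l// /a -!sqr_nrm2.
    have := sqr_ge0 (nrm2 (xt - xs) - nrm2 (u K - xs)); lra.
  move=> /(ler_wpM2l (ltW alpha0)); rewrite -/(a K) -/(d K).
  move: (dotv (r K) _) (dotv (D K) _) (dotv (v K) _) (QS _ _ _ _) (a K) (d K).
  move: (fS _ _ _ _) (fS _ _ _ _) (dotv _ _) (dotv _ _) (F x) (F xs).
  move=> *; lra.
have B0 : (0 < #|{: batch N b}|)%N by rewrite card_ffun !card_ord expn_gt0 N0.
have := ler_mean step; rewrite meanZ !meanD !mean_cst// !meanZ !meanD !mean_cst//.
rewrite !meanN mean_fS// mean_fS// mean_QS// !subrr.
have -> : mean (fun K => dotv (v K) (xs - x)) = 0.
  rewrite /v; under eq_mean do rewrite dotvDl dotvNl.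
  by rewrite meanD mean_cst// meanN mean_gradfS// subrr.
have cross : 2 * mean (fun K => dotv (D K) (u K - x)) <=
    c * k%:R * Lb / 2 * mean d + c * Lb / k%:R * dotv (x - xt) (x - xt).
  by rewrite -meanZ; exact: mean_cross_term.
move/(ler_wpM2l (ltW alpha0)): cross.
have := MNle (x - xs) => /(ler_wpM2l (ltW alpha0)).
move: (mean a) (mean d) (mean (fun K => dotv (D K) (u K - x))) => ma md mD.
move: (dotv (x - xs) (x - xs)) (dotv (x - xs) _) => xx xMx.
by move=> *; lra.
Qed.

End AveragedStep.

(** * Scalar recursions for one epoch *)

Section Recursion.
Context {R : realType}.

(* The solution of [D 0 = 0], [D (k + 1) = 2 D k + 4]. *)
Definition error_growth (k : nat) : R := 4 * (2 ^+ k - 1).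

Lemma error_growth_ge0 k : 0 <= error_growth k.
Proof. by rewrite /error_growth mulr_ge0// subr_ge0 exprn_ege1// ler1n. Qed.

(** The hypothesis is implicit in [V k.+1]. Absorbing with [eta <= 1 / 2] first gives a crude
    multiple of [V 0]; substituting it into the term carrying [eta] gives the sharp bound. The
    factor [rho] is gained only at the first step. *)
Lemma perturbed_recursion (V : nat -> R) (rho eta : R) (mm : nat) :
  (forall k, 0 <= V k) -> 0 <= rho <= 1 -> 0 <= eta <= 1 / 2 ->
  (forall k, (k < mm)%N ->
    V k.+1 <= (if k == 0%N then rho else 1) * V k + eta * (V 0 + V k.+1)) ->
  (0 < mm)%N -> V mm <= (rho + error_growth mm * eta) * V 0%N.
Proof.
move=> V0 /andP[rho0 rho1] /andP[eta0 eta2] rec mm0.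
have E : forall k, (k < mm)%N -> V k.+1 <= (rho + error_growth k.+1 * eta) * V 0%N.
  elim=> [|k ih] kmm.
    have /= h := rec _ kmm.
    have v1 := V0 1%N; have v0 := V0 0%N.
    have e1 : eta * V 1%N <= 1 / 2 * V 1%N by rewrite ler_wpM2r.
    have e2 : eta * V 0%N <= 1 / 2 * V 0%N by rewrite ler_wpM2r.
    have r1 : rho * V 0%N <= 1 * V 0%N by rewrite ler_wpM2r.
    have v3 : V 1%N <= 3 * V 0%N by move: h e1 e2 r1; lra.
    have := ler_wpM2l eta0 v3; rewrite /error_growth expr1.
    move: h; lra.
  have /= := rec _ kmm; have {}ih := ih (ltnW kmm).
  have G0 := error_growth_ge0 k.+1.
  have -> : error_growth k.+2 = 2 * error_growth k.+1 + 4.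
    by rewrite /error_growth exprS; ring.
  move: ih G0; move: (error_growth k.+1) => G ih G0.
  rewrite mul1r => h; have v2 := V0 k.+2; have v0 := V0 0%N.
  have e1 : eta * V k.+2 <= 1 / 2 * V k.+2 by rewrite ler_wpM2r.
  have e2 : eta * V 0%N <= 1 / 2 * V 0%N by rewrite ler_wpM2r.
  have r1 : rho * V 0%N <= 1 * V 0%N by rewrite ler_wpM2r.
  have gv : 0 <= G * V 0%N by rewrite mulr_ge0.
  have e3 : eta * (G * V 0%N) <= 1 / 2 * (G * V 0%N) by rewrite ler_wpM2r.
  have v3 : V k.+2 <= (3 + G) * V 0%N by move: h e1 e2 e3 r1 ih; lra.
  have := ler_wpM2l eta0 v3; move: h ih; lra.
by case: mm mm0 E {rec} => // mm _ E; exact: E.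
Qed.

(** The weight is 0 at both ends: at [k = mm] by the numerator, and at [k = 0] because division by
    zero returns 0. Both end potentials are thus pure distances to the minimiser. *)
Definition potential_weight (beta : R) (mm k : nat) : R :=
  beta * (mm%:R ^+ 2 - k%:R ^+ 2) / k%:R.

Lemma potential_weight_ge0 beta mm k : 0 <= beta -> (k <= mm)%N ->
  0 <= potential_weight beta mm k.
Proof.
move=> b0 kmm; rewrite /potential_weight divr_ge0// mulr_ge0// subr_ge0.
by rewrite ler_sqr ?nnegrE// ler_nat.
Qed.

(* With weight [beta (mm^2 - k^2) / k] on the squared distance to the epoch
   start, Young's inequality at ratio [1 / k] telescopes. *)
Lemma potential_decrease (beta q rho c1 X Y Ma Md Mt E : R) (mm k : nat) :
  0 <= beta -> 0 <= q -> (k < mm)%N -> 0 <= X -> 0 <= Y -> 0 <= Md ->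
  rho <= 1 -> beta * mm%:R ^+ 2 <= c1 ->
  q * Ma <= rho * (q * X) - c1 * Md + 2 * beta * Y + E ->
  (k = 0%N -> Mt = Md) ->
  ((0 < k)%N -> k%:R * Mt <= (k%:R + 1) * Y + k%:R * (k%:R + 1) * Md) ->
  q * Ma + potential_weight beta mm k.+1 * Mt <=
  (if k == 0%N then rho else 1) * (q * X) + potential_weight beta mm k * Y
  + (if k == 0%N then 2 * beta * Y else 0) + E.
Proof.
move=> be0 q0 kmm X0 Y0 Md0 rho1 bc1 step Mt0 Mtk.
have [k0|k0] := posnP k.
  rewrite (Mt0 k0) k0 /potential_weight invr0 mulr0 mul0r addr0 divr1 expr1n.
  have : (beta * (mm%:R ^+ 2 - 1)) * Md <= c1 * Md.
    by rewrite ler_wpM2r// (le_trans _ bc1)// ler_wpM2l// lerBlDr lerDl.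
  move: step; lra.
rewrite mul1r addr0.
have kR : 0 < k%:R :> R by rewrite ltr0n.
have P0 : 0 <= beta * (mm%:R ^+ 2 - (k%:R + 1) ^+ 2) :> R.
  by rewrite mulr_ge0// subr_ge0 natr1 ler_sqr ?nnegrE// ler_nat.
have rq : rho * (q * X) <= q * X by rewrite -[leRHS]mul1r ler_wpM2r// mulr_ge0.
set P := beta * (_ - _) in P0.
have PMt : potential_weight beta mm k.+1 * Mt <= P / k%:R * Y + P * Md.
  rewrite /potential_weight -natr1 -/P -mulrA [_^-1 * _]mulrC.
  have -> : P / k%:R * Y + P * Md =
      P * (((k%:R + 1) * Y + k%:R * (k%:R + 1) * Md) / k%:R / (k%:R + 1)).
    by field; rewrite !lt0r_neq0// addr_gt0.
  rewrite ler_wpM2l// ler_pM2r ?invr_gt0 ?addr_gt0//.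
  by rewrite ler_pdivlMr// mulrC Mtk.
have PMd : P * Md <= c1 * Md.
  rewrite ler_wpM2r// (le_trans _ bc1)// /P ler_wpM2l//.
  by rewrite lerBlDr lerDl sqr_ge0.
(* From [(k + 1)^2 = k^2 + 2 k + 1], the summand [2 k] pays for the noise term [2 * beta * Y]. *)
have PY : P / k%:R * Y + 2 * beta * Y <= potential_weight beta mm k * Y.
  rewrite -mulrDl ler_wpM2r// /potential_weight ler_pdivlMr// mulrDl divfK ?gt_eqF//.
  by rewrite /P; lra.
move: step PMt PMd PY rq; lra.
Qed.

End Recursion.

(** * Contraction of the algorithm over one epoch *)

Section Epoch.
Context {R : realType} (N n : nat) (m : 'I_N -> nat).
Variables (A : forall i : 'I_N, 'M[R]_(m i, n)) (f : forall i, 'cV[R]_(m i) -> R).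
Variables (gam Li : 'I_N -> R).
Arguments f : clear implicits.
Hypothesis N0 : (0 < N)%N.
Hypothesis fA1 : forall i, Lsmooth (Li i) (f i) /\ weakly_convex (gam i) (f i).
Variables (b : nat) (alpha L s mu : R) (phi : 'cV[R]_n -> \bar R) (xs : 'cV[R]_n).
Hypotheses (b0 : (0 < b)%N) (alpha0 : 0 < alpha).

Local Notation dF := (gradf R N n m A f).
Local Notation Lb := (Lbar R N n m A Li).
Local Notation dFS := (gradfS R N n m A f b).
Local Notation MK := (MS R N n m A gam b).
Local Notation psi := (psi R N n m A f phi).

Hypotheses (pphi : proper_efun phi) (lphi : lsc_efun phi).
Hypotheses (cphi : convex_efun phi) (sphi : strongly_convex_efun s phi).
Hypothesis dFlip : forall x y, nrm2 (dF x - dF y) <= L * nrm2 (x - y).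
Hypothesis mu_psi : strongly_convex_efun mu psi.
Hypothesis xsmin : forall y, (psi xs <= psi y)%E.
Hypothesis MNle : forall x,
  mu * dotv x x <= s * dotv x x - dotv x (MN R N n m A gam *m x).
Hypotheses (mu0 : 0 <= mu) (s_ge_mu : mu <= s).
Variable mm : nat.
Hypothesis mm0 : (0 < mm)%N.
Hypothesis alphale : alpha * (L + Num.sqrt (2 / b%:R) * mm%:R * Lb) <= 1.

Let q := 1 + alpha * (s + mu).
(** Chosen so that [rho * q = 1 + alpha * (s - mu)], the factor delivered by [mean_step]. *)
Let rho := 1 - 2 * alpha * mu / q.
(** Half the coefficient of the distance to the epoch start in [mean_step], with its parameter [k]
    taken to be [mm]. *)
Let beta := alpha * Num.sqrt (2 / b%:R) * Lb / mm%:R / 2.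

Let q_ge1 : 1 <= q.
Proof. by rewrite lerDl mulr_ge0 ?(ltW alpha0)// addr_ge0// (le_trans mu0). Qed.

Let q0 : 0 < q. Proof. exact: lt_le_trans q_ge1. Qed.

Let rhoq : rho * q = 1 + alpha * (s - mu).
Proof. by rewrite mulrBl divfK ?gt_eqF// /q; ring. Qed.

Let rho01 : 0 <= rho <= 1.
Proof.
apply/andP; split; last first.
  by rewrite lerBlDr lerDl divr_ge0 ?(ltW q0)// !mulr_ge0// ltW.
by rewrite -(pmulr_lge0 _ q0) rhoq addr_ge0// mulr_ge0 ?subr_ge0// ltW.
Qed.

Let beta0 : 0 <= beta.
Proof. by rewrite !divr_ge0// mulr_ge0 ?Lbar_ge0// mulr_ge0 ?sqrtr_ge0// ltW. Qed.

Lemma epoch_step (u r : batch N b -> 'cV[R]_n) x xt (e : R) (k : nat) :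
  (k < mm)%N -> 0 <= e -> (k = 0%N -> x = xt) ->
  (forall K, u K = prox alpha phi (x - alpha *: (dFS K (u K) + MK K *m u K + r K)
      - alpha *: ((dF xt - dFS K xt) - MK K *m x))) ->
  (forall K, nrm2 (r K) <= e * nrm2 (xt - xs)) ->
  mean (fun K => q * dotv (u K - xs) (u K - xs)
    + potential_weight beta mm k.+1 * dotv (u K - xt) (u K - xt)) <=
  (if k == 0%N then rho else 1) * (q * dotv (x - xs) (x - xs)
    + potential_weight beta mm k * dotv (x - xt) (x - xt))
  + alpha * e * (dotv (xt - xs) (xt - xs) +
                 mean (fun K => dotv (u K - xs) (u K - xs))).
Proof.
move=> kmm e0 x0 uE re; rewrite meanD !meanZ.
have := mean_step N0 fA1 b0 alpha0 pphi lphi cphi sphi dFlip mu_psi xsmin MNle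
  mm0 erefl e0 uE re.
set c := Num.sqrt _; rewrite -/q -rhoq.
have mR : 0 < mm%:R :> R by rewrite ltr0n.
have -> : alpha * (c * Lb / mm%:R) = 2 * beta.
  by rewrite /beta -/c; field; exact: lt0r_neq0.
(* The bound on the step size enters here: the left side equals [alpha * (c * mm%:R * Lb / 2)], so
   the inequality is exactly [alphale]. *)
have bc1 : beta * mm%:R ^+ 2 <= 1 - alpha * L - alpha * (c * mm%:R * Lb / 2).
  have -> : beta * mm%:R ^+ 2 = alpha * (c * mm%:R * Lb / 2).
    by rewrite /beta -/c; field; exact: lt0r_neq0.
  by move: alphale; rewrite -/c; lra.
rewrite -[rho * q * _]mulrA => step.
have Md0 : 0 <= mean (fun K => dotv (u K - x) (u K - x)).
  by apply: mean_ge0 => K; exact: dotv_ge0.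
have Mt0 : k = 0%N -> mean (fun K => dotv (u K - xt) (u K - xt)) =
    mean (fun K => dotv (u K - x) (u K - x)).
  by move=> k0; rewrite (x0 k0).
have B0 : (0 < #|{: batch N b}|)%N by rewrite card_ffun !card_ord expn_gt0 N0.
(* Young's inequality with ratio [1 / k] for [(u K - x) + (x - xt)], multiplied by [k]. *)
have Mtk : (0 < k)%N -> k%:R * mean (fun K => dotv (u K - xt) (u K - xt)) <=
    (k%:R + 1) * dotv (x - xt) (x - xt) +
    k%:R * (k%:R + 1) * mean (fun K => dotv (u K - x) (u K - x)).
  move=> k0; rewrite -!meanZ -(mean_cst ((k%:R + 1) * dotv (x - xt) (x - xt)) B0).
  rewrite -meanD; apply: ler_mean => K.
  have -> : u K - xt = (u K - x) + (x - xt) by rewrite subrKA.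
  have := mulr_dotv_le (k%:R) 1 (u K - x) (x - xt); move: (u K - x) (x - xt) => w1 w2.
  rewrite !dotvE (dotvC w2 w1); lra.
have := potential_decrease beta0 (ltW q0) kmm (dotv_ge0 _) (dotv_ge0 _) Md0
  (andP rho01).2 bc1 step Mt0 Mtk.
case: eqP => [k0|_]; last by move: (alpha * e * _) => E; rewrite !mul1r addr0.
by rewrite k0 /potential_weight invr0 !mulr0 !mul0r (x0 k0) subrr dotv0l !mulr0 !addr0.
Qed.

Variables (x0 : 'cV[R]_n) (delta : nat -> R) (sel : seq (batch N b) -> dualv R N m b).
Local Notation run := (run R N n m A f gam phi b alpha mm x0 sel).
Hypothesis ediff : forall i, ess_differentiable (fhat_conj R N m f gam i).
Hypothesis delta0 : forall k, 0 < delta k.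
Hypothesis sel_accurate : forall (K : batch N b) (hr : seq (batch N b)),
  let st := run hr in
  (forall j : 'I_b, Dom R N m f gam (K j) (sel (K :: hr) j (K j))) /\
  Vnorm R N n m A f gam phi b K alpha st.2
    (- vhat R N n m A f gam b alpha K st.1 st.2) (sel (K :: hr))
    <= delta (size hr %/ mm)%N * nrm2 (Fnat R N n m A f phi st.1).

Lemma run_epoch_start hr : (mm %| size hr)%N -> (run hr).1 = (run hr).2.
Proof. by case: hr => [//|K hr] /=; rewrite /dvdn => ->. Qed.

Lemma run_anchor K hr : ~~ (mm %| (size hr).+1)%N -> (run (K :: hr)).1 = (run hr).1.
Proof. by rewrite /dvdn /= => /negPf ->. Qed.

Definition next_iterate hr K := (run (K :: hr)).2.

Definition dual_error hr K : 'cV[R]_n := ASt R N n m A b K (sel (K :: hr))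
  - (dFS K (next_iterate hr K) + MK K *m next_iterate hr K).

(** Adding and subtracting the primal gradient at the new iterate turns the explicit dual update
    into the implicit equation that [epoch_step] takes as hypothesis. *)
Lemma next_iterateE hr K : next_iterate hr K = prox alpha phi ((run hr).2
  - alpha *: (dFS K (next_iterate hr K) + MK K *m next_iterate hr K + dual_error hr K)
  - alpha *: ((dF (run hr).1 - dFS K (run hr).1) - MK K *m (run hr).2)).
Proof.
rewrite /dual_error [_ + (ASt _ _ _ _ _ _ _ _ - _)]addrC subrK.
by rewrite /next_iterate /=; case: ifP.
Qed.

Definition error_const : R := residual_const A gam Li * (2 + `|L|).

Lemma error_const_ge0 : 0 <= error_const.
Proof. by rewrite mulr_ge0 ?addr_ge0// (residual_const_ge0 _ fA1). Qed.

(** The dual residual is controlled by the tolerance, hence by the natural residual at the epoch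
    start, hence by the distance of that point to [xs]. *)
Lemma dual_error_le hr K : nrm2 (dual_error hr K) <=
  error_const * delta (size hr %/ mm)%N * nrm2 ((run hr).1 - xs).
Proof.
have [selD selV] := sel_accurate K hr.
have uV : Num.sqrt (\sum_(j < b) nrm2 (grad_fhat_conj R N m f gam (K j)
    (sel (K :: hr) j (K j)) - A (K j) *m next_iterate hr K) ^+ 2) <=
    delta (size hr %/ mm)%N * nrm2 (Fnat R N n m A f phi (run hr).1).
  by rewrite /next_iterate /=; case: ifP => _; exact: selV.
apply: (le_trans (dual_residual_le fA1 b0 ediff selD uV)).
rewrite /error_const -!mulrA ler_wpM2l ?(residual_const_ge0 _ fA1)//.
rewrite [leRHS]mulrCA ler_wpM2l ?(ltW (delta0 _))//.
exact: (natural_residual_le (fsum_descent fA1 dFlip) dFlip pphi lphi cphi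
  (le_trans mu0 s_ge_mu) sphi xsmin).
Qed.

Definition potential (t k : nat) : R := Exp R N b (t * mm + k)%N (fun hr =>
  q * dotv ((run hr).2 - xs) ((run hr).2 - xs)
  + potential_weight beta mm k *
    dotv ((run hr).2 - (run hr).1) ((run hr).2 - (run hr).1)).

(** The epoch start does not move before the epoch ends, so the later draws average out. *)
Lemma Exp_anchor (g : 'cV[R]_n -> R) t k : (k < mm)%N ->
  Exp R N b (t * mm + k)%N (fun hr => g (run hr).1) =
  Exp R N b (t * mm)%N (fun hr => g (run hr).1).
Proof.
elim: k => [|k ih] kmm; first by rewrite addn0.
rewrite addnS ExpS -(ih (ltnW kmm)); apply: eq_Exp => hr szhr.
rewrite -[RHS](@mean_cst _ {ffun 'I_b -> 'I_N}); last first.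
  by rewrite card_ffun !card_ord expn_gt0 N0.
apply: eq_mean => K; rewrite run_anchor// szhr -addnS /dvdn modnMDl.
by rewrite modn_small// -lt0n.
Qed.

Lemma potential_step t k : (k < mm)%N ->
  potential t k.+1 <= (if k == 0%N then rho else 1) * potential t k
    + alpha * (error_const * delta t) * (potential t 0 + potential t k.+1).
Proof.
move=> kmm; set eta := alpha * _.
have e0 : 0 <= error_const * delta t by rewrite mulr_ge0 ?error_const_ge0 ?(ltW (delta0 _)).
have eta0 : 0 <= eta by rewrite mulr_ge0// ltW.
have p0 := potential_weight_ge0 beta0 kmm.
pose nxt hr := mean (fun K => q * dotv (next_iterate hr K - xs) (next_iterate hr K - xs)
  + potential_weight beta mm k.+1 *
    dotv (next_iterate hr K - (run hr).1) (next_iterate hr K - (run hr).1)).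
have potS : potential t k.+1 = Exp R N b (t * mm + k)%N nxt.
  rewrite /potential addnS ExpS; apply: eq_Exp => hr szhr.
  apply: eq_mean => K; rewrite -/(next_iterate hr K).
  (* At the last inner step [run] has already replaced the epoch start, but the weight is 0
     there. *)
  have [km|km] := eqVneq k.+1 mm.
    by rewrite km /potential_weight subrr mulr0 !mul0r.
  have k1mm : (k.+1 < mm)%N by rewrite ltn_neqAle km.
  by rewrite run_anchor// szhr -addnS /dvdn modnMDl modn_small.
(* Since [1 <= q], plain squared distances are bounded by the potential; this lets the residual
   terms be fed back into the recursion. *)
have le1 : Exp R N b (t * mm)%N (fun hr => dotv ((run hr).1 - xs) ((run hr).1 - xs))
    <= potential t 0.
  rewrite /potential addn0; apply: ler_Exp => hr szhr.
  rewrite -run_epoch_start ?szhr ?dvdn_mull// subrr dotv0l mulr0 addr0.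
  by rewrite ler_peMl// dotv_ge0.
have le2 : Exp R N b (t * mm + k)%N (fun hr => mean (fun K =>
    dotv (next_iterate hr K - xs) (next_iterate hr K - xs))) <= potential t k.+1.
  rewrite potS; apply: ler_Exp => hr _; apply: ler_mean => K.
  by apply: ler_wpDr; [rewrite mulr_ge0// dotv_ge0|rewrite ler_peMl// dotv_ge0].
apply: (@le_trans _ _ ((if k == 0%N then rho else 1) * potential t k + eta *
  (Exp R N b (t * mm)%N (fun hr => dotv ((run hr).1 - xs) ((run hr).1 - xs)) +
   Exp R N b (t * mm + k)%N (fun hr => mean (fun K =>
     dotv (next_iterate hr K - xs) (next_iterate hr K - xs)))))); last first.
  by rewrite lerD2l; exact: (ler_wpM2l eta0 (lerD le1 le2)).
rewrite [leLHS]potS.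
rewrite -(Exp_anchor (fun v => dotv (v - xs) (v - xs)) _ kmm).
rewrite /potential -ExpD -!ExpZ -ExpD; apply: ler_Exp => hr szhr.
have szt : (size hr %/ mm)%N = t by rewrite szhr divnMDl// divn_small// addn0.
apply: (epoch_step (r := dual_error hr) kmm e0 _ (next_iterateE hr)) => [k0|K].
  by rewrite run_epoch_start// szhr k0 addn0 dvdn_mull.
by rewrite -szt dual_error_le.
Qed.

Lemma epoch_contraction t : alpha * (error_const * delta t) <= 1 / 2 ->
  Exp R N b (t.+1 * mm)%N (fun hr => nrm2 ((run hr).1 - xs) ^+ 2) <=
  (rho + error_growth mm * (alpha * (error_const * delta t))) *
  Exp R N b (t * mm)%N (fun hr => nrm2 ((run hr).1 - xs) ^+ 2).
Proof.
move=> eta2.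
have eta0 : 0 <= alpha * (error_const * delta t).
  by rewrite mulr_ge0 ?(ltW alpha0)// mulr_ge0 ?error_const_ge0 ?(ltW (delta0 _)).
have pot0 : potential t 0 = q * Exp R N b (t * mm)%N
    (fun hr => nrm2 ((run hr).1 - xs) ^+ 2).
  rewrite /potential addn0 -ExpZ; apply: eq_Exp => hr szhr.
  by rewrite -run_epoch_start ?szhr ?dvdn_mull// subrr dotv0l mulr0 addr0 sqr_nrm2.
have potm : potential t mm = q * Exp R N b (t.+1 * mm)%N
    (fun hr => nrm2 ((run hr).1 - xs) ^+ 2).
  rewrite /potential mulSn [(mm + _)%N]addnC -ExpZ; apply: eq_Exp => hr szhr.
  rewrite -run_epoch_start ?szhr ?dvdn_addl ?dvdn_mull//.
  by rewrite subrr dotv0l mulr0 addr0 sqr_nrm2.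
have pot_ge0 k : (k <= mm)%N -> 0 <= potential t k.
  move=> kmm; apply: mean_ge0 => hr.
  apply: addr_ge0; apply: mulr_ge0; rewrite ?dotv_ge0 ?(ltW q0)//.
  exact: potential_weight_ge0.
rewrite -(ler_pM2l q0) [leRHS]mulrCA -pot0 -potm.
(* The recursion lemma asks for nonnegativity at every [k], whereas the weight may become negative
   past [mm]; hence the truncation. *)
pose V k := if (k <= mm)%N then potential t k else 0.
have := @perturbed_recursion R V rho (alpha * (error_const * delta t)) mm.
rewrite /V leqnn leq0n; apply => //; first by move=> k; case: ifP => //; exact: pot_ge0.
  by rewrite eta0.
by move=> k kmm; rewrite kmm (ltnW kmm); exact: potential_step.
Qed.

End Epoch.

(** * Choice of the constant and of the starting index *)

Unset Implicit Arguments.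

Theorem theorem6p4
  (R : realType) (N n : nat) (m : 'I_N -> nat)
  (A : forall i : 'I_N, 'M[R]_(m i, n))
  (f : forall i : 'I_N, 'cV[R]_(m i) -> R)
  (gam Li : 'I_N -> R) (L : R)
  (phi : 'cV[R]_n -> \bar R) (nu mu_phi mu : R) (xstar : 'cV[R]_n)
  (alpha : R) (b mm : nat) (x0 : 'cV[R]_n) (delta : nat -> R)
  (sel : seq (batch N b) -> dualv R N m b) :
  (0 < N)%N ->
  (* (A1) *)
  (forall i, Lsmooth (Li i) (f i) /\ weakly_convex (gam i) (f i)) ->
  (* L is the Lipschitz constant of grad f *)
  (forall x y, nrm2 (gradf R N n m A f x - gradf R N n m A f y) <= L * nrm2 (x - y)) ->
  (* phi proper closed convex *)
  proper_efun phi -> lsc_efun phi -> convex_efun phi ->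
  (* (A2) *)
  (exists c : R, forall x, (c%:E <= psi R N n m A f phi x)%E) ->
  (* (A4) *)
  (forall i, ess_differentiable (fhat_conj R N m f gam i) /\
             locally_lipschitz_on (Dom R N m f gam i) (grad_fhat_conj R N m f gam i)) ->
  (* (A~3) *)
  0 < nu <= 1 ->
  (forall a : R, 0 < a -> semismooth_on nu setT (prox a phi)) ->
  (* (A~5) *)
  (forall i, semismooth_on nu (Dom R N m f gam i) (grad_fhat_conj R N m f gam i)) ->
  (* strong convexity *)
  strongly_convex_efun mu_phi phi ->
  0 < mu -> strongly_convex_efun mu (psi R N n m A f phi) ->
  (forall x : 'cV[R]_n,
     mu * dotv x x <= mu_phi * dotv x x - dotv x (MN R N n m A gam *m x)) ->
  (* x* is the (unique) minimizer of psi *)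
  (forall y, (psi R N n m A f phi xstar <= psi R N n m A f phi y)%E) ->
  (* parameters of SNSPP (S = oo, Option I, constant step and batch sizes) *)
  (0 < mm)%N -> (0 < b)%N -> 0 < alpha ->
  alpha <= (L + Num.sqrt (2 / b%:R) * mm%:R * Lbar R N n m A Li)^-1 ->
  (forall s, 0 < delta s) -> delta @ \oo --> 0 ->
  (* subproblem accuracy: xi^{s,k+1} in D and
     ||V(xi^{s,k+1})|| <= eps_k^s <= delta_s ||F_nat(tilde x^s)|| *)
  (forall (K : batch N b) (hr : seq (batch N b)),
     let st := run R N n m A f gam phi b alpha mm x0 sel hr in
     (forall j : 'I_b, Dom R N m f gam (K j) (sel (K :: hr) j (K j))) /\
     Vnorm R N n m A f gam phi b K alpha st.2
        (- vhat R N n m A f gam b alpha K st.1 st.2) (sel (K :: hr))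
       <= delta (size hr %/ mm)%N * nrm2 (Fnat R N n m A f phi st.1)) ->
  exists C : R, 0 < C /\ exists s0 : nat, forall s : nat, (s0 <= s)%N ->
    Exp R N b (s.+1 * mm)%N
      (fun hr => nrm2 ((run R N n m A f gam phi b alpha mm x0 sel hr).1 - xstar) ^+ 2)
    <= (1 - 2 * alpha * mu / (1 + alpha * (mu_phi + mu)) + C * delta s) *
       Exp R N b (s * mm)%N
      (fun hr => nrm2 ((run R N n m A f gam phi b alpha mm x0 sel hr).1 - xstar) ^+ 2).
Proof.
move=> N0 fA1 dFlip pphi lphi cphi _ A4 _ _ _ sphi mu0 mu_psi MNle xsmin mm0 b0.
move=> alpha0 alphale delta0 deltacv sel_accurate.
(* In dimension 0 all distances vanish. Otherwise a basis vector exists, and testing [MNle] on it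
   gives [mu <= mu_phi]. *)
have [n0|n0] := posnP n.
  have nrm2_0 (x : 'cV[R]_n) : nrm2 x = 0.
    by rewrite /nrm2 /dotv big1 ?sqrtr0// => i; have := ltn_ord i; 
      rewrite [X in (_ < X)%N]n0.
  exists 1; split=> //; exists 0%N => t _.
  have Exp0 (g : seq (batch N b) -> 'cV[R]_n) T :
      Exp R N b T (fun hr => nrm2 (g hr) ^+ 2) = 0.
    by rewrite /Exp big1 ?mulr0// => w _; rewrite nrm2_0 expr0n.
  by rewrite !Exp0 mulr0.
have mu_le : mu <= mu_phi.
  have := MNle (delta_mx (Ordinal n0) 0); rewrite dotv_delta mxE !eqxx !mulr1.
  move=> /le_trans; apply; rewrite lerBlDr lerDl dotv_MN; apply: mean_ge0 => i.
  exact: (quad_comp_ge0 _ fA1).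
(* A positive [alpha] below the inverse forces the inverted quantity to be positive, so multiplying
   out is legitimate. *)
have alphaX : alpha * (L + Num.sqrt (2 / b%:R) * mm%:R * Lbar R N n m A Li) <= 1.
  have := lt_le_trans alpha0 alphale; rewrite invr_gt0 => X0.
  by rewrite -ler_pdivlMr// div1r.
have c0 : 0 <= alpha * error_const A gam Li L.
  by rewrite mulr_ge0 ?(ltW alpha0)// (error_const_ge0 _ fA1).
set c := alpha * _ in c0.
(* The summand 1 only secures strict positivity, as [c] may be 0. *)
exists (error_growth mm * c + 1); split.
  by rewrite ltr_wpDl// mulr_ge0// error_growth_ge0.
(* Once [delta] is below this threshold, [c * delta t] is at most [1 / 2], as [epoch_contraction]
   requires. *)
have d0 : 0 < 1 / 2 / (c + 1) by rewrite divr_gt0// ltr_wpDl.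
have /cvgrPdist_lt/(_ _ d0)[s0 _ s0P] := deltacv.
exists s0 => t s0t; have := s0P t s0t; rewrite /= sub0r normrN gtr0_norm// => dt.
have eta2 : alpha * (error_const A gam Li L * delta t) <= 1 / 2.
  rewrite mulrA -/c; apply: (@le_trans _ _ ((c + 1) * delta t)).
    by rewrite ler_wpM2r ?(ltW (delta0 _))// lerDl.
  by rewrite mulrC -ler_pdivlMr ?ltr_wpDl// ltW.
apply: le_trans (epoch_contraction N0 fA1 b0 alpha0 pphi lphi cphi sphi dFlip mu_psi
  xsmin MNle (ltW mu0) mu_le mm0 alphaX (fun i => (A4 i).1) delta0 sel_accurate eta2) _.
rewrite ler_wpM2r//; first by apply: mean_ge0 => hr; rewrite sqr_ge0.
rewrite lerD2l [alpha * _]mulrA -/c mulrA.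
by apply: ler_wpM2r; [exact: ltW | rewrite lerDl].
Qed.
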